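(* Let $(\Omega,\Sigma,\mu)$ be a measure space such that the real Banach space $L_1(\mu)$ has a predual which is weakly Hahn-Banach smooth, i.e. there is a Banach space $X$ with $X^*$ isometrically isomorphic to $L_1(\mu)$ and $X$ weakly Hahn-Banach smooth. Then $L_1(\mu)$ is isometrically isomorphic to $\ell_1(\Gamma)$ for some discrete set $\Gamma$.
   Context: All Banach spaces are over the reals. A Banach space $X$ is weakly Hahn-Banach smooth if every $x^*\in X^*$ which attains its norm on the closed unit ball of $X$ has a unique norm-preserving linear extension from $X$ (canonically embedded in $X^{**}$) to $X^{**}$. *)

(* Defs.v *)
From HB Require Import structures.
From mathcomp Require Import all_boot all_order all_algebra.
From mathcomp Require Import all_classical all_reals all_analysis.
From mathcomp Require Import measurable_realfun.

Set Implicit Arguments.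
Unset Strict Implicit.
Unset Printing Implicit Defensive.

Import Order.TTheory GRing.Theory Num.Theory.
Import numFieldNormedType.Exports.

Local Open Scope classical_set_scope.
Local Open Scope ring_scope.

Definition isometrically_isomorphic (R : realType) (V W : normedModType R) :
    Prop :=
  exists2 T : {linear V -> W}, bijective T & forall x, `|T x| = `|x|.

Section dual_space.
Context (R : realType) (V : normedModType R).

Definition bounded_functional : {pred V -> R^o} :=
  [pred f | `[< linear f /\ continuous f >]].

Lemma bounded_functional_submod_closed : submod_closed bounded_functional.
Proof.
split=> [|a f g /asboolP[lf cf] /asboolP[lg cg]]; apply/asboolP; split.
- by move=> k x y; rewrite /= scaler0 addr0.
- exact: cst_continuous.
- move=> k x y; rewrite !fctE lf lg !scalerDr !scalerA (mulrC a k).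
  by rewrite addrACA.
- move=> x; apply: cvgD; last exact: cg.
  by apply: cvgZl_tmp; exact: cf.
Qed.

HB.instance Definition _ := GRing.isSubmodClosed.Build _ _ bounded_functional
  bounded_functional_submod_closed.

Record dual_space := DualSpace {
  dual_fun :> V -> R^o;
  dual_funP : dual_fun \in bounded_functional }.

HB.instance Definition _ := [isSub for dual_fun].
HB.instance Definition _ := [Choice of dual_space by <:].
HB.instance Definition _ := [SubChoice_isSubLmodule of dual_space by <:].

Lemma dual_linear (f : dual_space) : linear f.
Proof. by have /asboolP[] := dual_funP f. Qed.

Lemma dual_continuous (f : dual_space) : continuous f.
Proof. by have /asboolP[] := dual_funP f. Qed.

HB.instance Definition _ (f : dual_space) :=
  GRing.isLinear.Build R V R^o *:%R (dual_fun f) (dual_linear f).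

Definition dual_norm (f : dual_space) : R :=
  sup [set `|f x| | x in [set x : V | `|x| <= 1]].

Lemma dual_norm_has_sup (f : dual_space) :
  has_sup [set `|f x| | x in [set x : V | `|x| <= 1]].
Proof.
split; first by exists `|f 0|, 0 => //=; rewrite normr0.
have /linear_bounded_continuous/bounded_funP/(_ 1)[M fM] :=
  dual_continuous (f := f).
by exists M => _ [x x1 <-]; exact: fM.
Qed.

Lemma dual_norm_le (f : dual_space) x : `|f x| <= dual_norm f * `|x|.
Proof.
have [->|x0] := eqVneq x 0; first by rewrite linear0 !normr0 mulr0.
rewrite -ler_pdivrMr ?normr_gt0//.
apply: ub_le_sup; first exact: (dual_norm_has_sup f).2.
exists (`|x|^-1 *: x) => /=.
  by rewrite normrZ normfV normr_id mulVf ?normr_eq0.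
by rewrite linearZ/= normrZ normfV normr_id mulrC.
Qed.

Lemma dual_norm_leP (f : dual_space) M :
  (forall x, `|x| <= 1 -> `|f x| <= M) -> dual_norm f <= M.
Proof.
move=> fM; apply: sup_le_ub; first exact: (dual_norm_has_sup f).1.
by move=> _ [x x1 <-]; exact: fM.
Qed.

Lemma dual_norm_ge0 (f : dual_space) : 0 <= dual_norm f.
Proof.
apply: (le_trans (normr_ge0 (f 0))); apply: ub_le_sup.
  exact: (dual_norm_has_sup f).2.
by exists 0 => //=; rewrite normr0.
Qed.

Lemma dual_normD (f g : dual_space) :
  dual_norm (f + g) <= dual_norm f + dual_norm g.
Proof.
apply: dual_norm_leP => x x1; apply: (le_trans (ler_normD (f x) (g x))).
apply: lerD; apply: (le_trans (dual_norm_le _ _));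
  by rewrite ler_piMr ?dual_norm_ge0.
Qed.

Lemma dual_normZ_le (a : R) (f : dual_space) :
  dual_norm (a *: f) <= `|a| * dual_norm f.
Proof.
apply: dual_norm_leP => x x1; rewrite [leLHS](normrZ a (f x)) ler_wpM2l//.
by apply: (le_trans (dual_norm_le _ _)); rewrite ler_piMr ?dual_norm_ge0.
Qed.

Lemma dual_normZ (a : R) (f : dual_space) :
  dual_norm (a *: f) = `|a| * dual_norm f.
Proof.
apply/eqP; rewrite eq_le dual_normZ_le/=.
have [->|a0] := eqVneq a 0; first by rewrite normr0 mul0r dual_norm_ge0.
rewrite -ler_pdivlMl ?normr_gt0// -normfV.
by apply: le_trans (dual_normZ_le _ _); rewrite scalerA mulVf// scale1r.
Qed.

Lemma dual_norm0_eq0 (f : dual_space) : dual_norm f = 0 -> f = 0.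
Proof.
move=> f0; apply/val_inj/funext => x /=.
apply/eqP; rewrite -normr_le0; apply: (le_trans (dual_norm_le _ _)).
by rewrite f0 mul0r.
Qed.

HB.instance Definition _ := Lmodule_isNormed.Build R dual_space
  dual_normD dual_normZ dual_norm0_eq0.

End dual_space.

Section Hahn_Banach_smoothness.
Context (R : realType) (X : normedModType R).

Lemma evaluation_subproof (x : X) :
  (fun f : dual_space X => f x) \in @bounded_functional R (dual_space X).
Proof.
apply/asboolP.
have lev : linear (fun f : dual_space X => f x) by [].
pose ev : {linear dual_space X -> R^o} :=
  HB.pack (fun f : dual_space X => f x) (GRing.isLinear.Build _ _ _ _ _ lev).
split=> //; apply: (bounded_linear_continuous (f := ev)).
apply/bounded_funP => r; exists (r * `|x|) => f fr.
by apply: (le_trans (dual_norm_le _ _)); rewrite ler_wpM2r.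
Qed.

Definition bidual_embedding (x : X) : dual_space (dual_space X) :=
  DualSpace (evaluation_subproof x).

Definition attains_norm (f : dual_space X) : Prop :=
  exists2 x : X, `|x| <= 1 & `|f x| = `|f|.

Definition norm_preserving_extension (f : dual_space X)
    (F : dual_space (dual_space (dual_space X))) : Prop :=
  (forall x, F (bidual_embedding x) = f x) /\ `|F| = `|f|.

Definition weakly_Hahn_Banach_smooth : Prop :=
  forall f : dual_space X, attains_norm f ->
    exists! F, norm_preserving_extension f F.

End Hahn_Banach_smoothness.

Section ell1.
Context (R : realType) (I : choiceType).

Lemma ge0_esumZl (r : R) (a : I -> \bar R) : 0 < r -> (forall i, 0 <= a i)%E ->
  (\esum_(i in [set: I]) (r%:E * a i) = r%:E * \esum_(i in [set: I]) a i)%E.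
Proof.
move=> r0 a0; rewrite /esum -ereal_sup_pZl//; congr ereal_sup.
rewrite image_comp; apply: eq_imagel => A _ /=.
by rewrite ge0_mule_fsumr.
Qed.

Definition absolutely_summable : {pred I -> R^o} :=
  [pred f | `[< summable [set: I] (EFin \o f) >]].

Lemma absolutely_summable_submod_closed : submod_closed absolutely_summable.
Proof.
split=> [|a f g /asboolP sf /asboolP sg]; apply/asboolP.
  by rewrite /summable esum1// => i _ /=; rewrite normr0.
have -> : EFin \o (a *: f + g) = (EFin \o (a *: f)) \+ (EFin \o g).
  by apply/funext => i.
apply: summableD => //; rewrite /summable.
under eq_esum do rewrite /= normrM EFinM.
have [->|a0] := eqVneq a 0.
  by rewrite esum1// => i _; rewrite normr0 mul0e.
rewrite ge0_esumZl ?normr_gt0//.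
by rewrite lte_mul_pinfty// ?lee_fin//; exact: sf.
Qed.

HB.instance Definition _ := GRing.isSubmodClosed.Build _ _ absolutely_summable
  absolutely_summable_submod_closed.

Record ell1 := Ell1 {
  ell1_fun :> I -> R^o;
  ell1_funP : ell1_fun \in absolutely_summable }.

HB.instance Definition _ := [isSub for ell1_fun].
HB.instance Definition _ := [Choice of ell1 by <:].
HB.instance Definition _ := [SubChoice_isSubLmodule of ell1 by <:].

Definition ell1_norm (f : ell1) : R := fine (\esum_(i in [set: I]) `|f i|%:E).

Lemma ell1_normE (f : ell1) :
  (ell1_norm f)%:E = (\esum_(i in [set: I]) `|f i|%:E)%E.
Proof.
by rewrite /ell1_norm fineK//; have /asboolP := ell1_funP f; rewrite summableE.
Qed.

Lemma ell1_normD (f g : ell1) : ell1_norm (f + g) <= ell1_norm f + ell1_norm g.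
Proof.
rewrite -lee_fin EFinD !ell1_normE -esumD; first last.
- by move=> i _; rewrite lee_fin.
- by move=> i _; rewrite lee_fin.
by apply: le_esum => i _; rewrite -EFinD lee_fin; exact: ler_normD.
Qed.

Lemma ell1_normZ (a : R) (f : ell1) : ell1_norm (a *: f) = `|a| * ell1_norm f.
Proof.
have [->|a0] := eqVneq a 0.
  rewrite scale0r normr0 mul0r /ell1_norm esum1// => i _.
  by rewrite /= normr0.
apply/EFin_inj; rewrite EFinM !ell1_normE -ge0_esumZl ?normr_gt0//.
by apply: eq_esum => i _; rewrite -EFinM /= normrM.
Qed.

Lemma ell1_norm0_eq0 (f : ell1) : ell1_norm f = 0 -> f = 0.
Proof.
move=> f0; apply/val_inj/funext => i /=.
apply/eqP; rewrite -normr_le0 -lee_fin -f0 ell1_normE; apply: esum_ge.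
exists [set i]; first by split.
by rewrite fsbig_set1.
Qed.

HB.instance Definition _ := Lmodule_isNormed.Build R ell1
  ell1_normD ell1_normZ ell1_norm0_eq0.

End ell1.

Section Lspace_normedModType.
Context d (T : measurableType d) (R : realType).
Variables (mu : {measure set T -> \bar R}) (p : \bar R) (p1 : (1 <= p)%E).
Local Notation Lsp := (LspaceType mu p1).
Local Notation Lf := (LfunType mu p1).
Local Open Scope quotient_scope.

Lemma ae_eq_Lnorm (f g : T -> R) : measurable_fun [set: T] f ->
  measurable_fun [set: T] g -> f = g %[ae mu] ->
  ('N[mu]_p[EFin \o f] = 'N[mu]_p[EFin \o g])%E.
Proof.
have mpow r (h : T -> R) : measurable_fun [set: T] h ->
    measurable_fun [set: T] (fun x => (`|(EFin \o h) x| `^ r)%E : \bar R).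
  move=> mh.
  have mah : measurable_fun [set: T] (abse \o (EFin \o h) : T -> \bar R).
    by apply: measurableT_comp => //; exact/measurable_EFinP.
  exact: measurableT_comp (measurable_poweR r) mah.
move=> mf mg fg; rewrite unlock; case: p p1 => [r r1| |//].
- congr poweR; apply: ge0_ae_eq_integral => //; [exact: mpow|exact: mpow|..].
  + by move=> x _; exact: poweR_ge0.
  + by move=> x _; exact: poweR_ge0.
  + by apply: filterS fg => x /= + xT => ->.
- move=> _; case: ifPn => // _; apply: ess_sup_inf.eq_ess_sup.
  by apply: filterS fg => x /= ->.
Qed.

Lemma Lspace_LfunP (f : Lsp) : (f : T -> R) \in Lfun mu p.
Proof.
apply/andP; split; rewrite inE/=.
  exact: (measurable_funPT (repr (f : {mfun_ mu, T >-> measurableTypeR R}))).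
exact: Lebesgue_finite.
Qed.

Definition Lspace_repr (f : Lsp) : Lf := Lfun_Sub p1 (Lspace_LfunP f).

(* [R] and [measurableTypeR R] have the same measurable sets but different
   displays; [LspaceType] is built on functions into the latter. *)
Definition mfun_measurableTypeR (f : Lf) : {mfun T >-> measurableTypeR R} :=
  HB.pack (f : T -> measurableTypeR R)
    (@isMeasurableFun.Build _ _ T (measurableTypeR R) f (measurable_funPT f)).

Definition Lspace_class (f : Lf) : {mfun_ mu, T >-> measurableTypeR R} :=
  \pi_{mfun_ mu, T >-> measurableTypeR R} (mfun_measurableTypeR f).

Lemma repr_Lspace_class (f : Lf) :
  (repr (Lspace_class f) : T -> R) = f %[ae mu].
Proof. by have /eqquotP/asboolP := reprK (Lspace_class f). Qed.

Lemma finite_norm_Lspace_class (f : Lf) : finite_norm mu p (Lspace_class f).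
Proof.
rewrite /finite_norm.
have mf : measurable_fun [set: T] (Lspace_class f : T -> R).
  exact: (measurable_funPT (repr (Lspace_class f))).
rewrite (ae_eq_Lnorm mf (measurable_funPT f) (repr_Lspace_class f)).
exact: Lfunction_finite.
Qed.

HB.instance Definition _ (f : Lf) :=
  isFinLebesgue.Build d T R mu p p1 (Lspace_class f) (finite_norm_Lspace_class f).

Definition Lspace_pi (f : Lf) : Lsp := Lspace_class f.

Lemma Lspace_inj (f g : Lsp) :
  (f : {mfun_ mu, T >-> measurableTypeR R}) = g -> f = g.
Proof.
case: f g => [f [[f1]]] [g [[g1]]] /= fg; case: _ / fg g1 => g1.
by rewrite (Prop_irrelevance f1 g1).
Qed.

Lemma Lspace_piP (f g : Lf) : Lspace_pi f = Lspace_pi g <-> f = g %[ae mu].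
Proof.
split=> [[/eqmodP/asboolP//]|fg].
by apply: Lspace_inj; apply/eqmodP/asboolP.
Qed.

Lemma Lspace_reprK : cancel Lspace_repr Lspace_pi.
Proof.
move=> f; apply: Lspace_inj => /=; rewrite -[RHS]reprK.
by apply/eqmodP/asboolP; exact: aeW.
Qed.

Lemma Lspace_piK (f : Lf) : Lspace_repr (Lspace_pi f) = f %[ae mu].
Proof. exact: repr_Lspace_class. Qed.

Definition Lspace_zero : Lsp := Lspace_pi 0.
Definition Lspace_opp (f : Lsp) : Lsp := Lspace_pi (- Lspace_repr f).
Definition Lspace_add (f g : Lsp) : Lsp :=
  Lspace_pi (Lspace_repr f + Lspace_repr g).
Definition Lspace_scale (a : R) (f : Lsp) : Lsp :=
  Lspace_pi (a *: Lspace_repr f).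

Lemma Lspace_piD (f g : Lf) : Lspace_pi (f + g) = Lspace_add (Lspace_pi f) (Lspace_pi g).
Proof.
apply/Lspace_piP; have := Lspace_piK f; have := Lspace_piK g.
by apply: filterS2 => x /= fx gx xT; rewrite !fctE fx// gx.
Qed.

Lemma Lspace_piN (f : Lf) : Lspace_pi (- f) = Lspace_opp (Lspace_pi f).
Proof.
apply/Lspace_piP; have := Lspace_piK f.
by apply: filterS => x /= fx xT; rewrite !fctE fx.
Qed.

Lemma Lspace_piZ a (f : Lf) : Lspace_pi (a *: f) = Lspace_scale a (Lspace_pi f).
Proof.
apply/Lspace_piP; have := Lspace_piK f.
by apply: filterS => x /= fx xT; rewrite !fctE fx.
Qed.

Lemma Lspace_ind (P : Lsp -> Prop) : (forall f, P (Lspace_pi f)) -> forall f, P f.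
Proof. by move=> Ppi f; rewrite -(Lspace_reprK f). Qed.

Lemma Lspace_addA : associative Lspace_add.
Proof.
elim/Lspace_ind=> f; elim/Lspace_ind=> g; elim/Lspace_ind=> h.
by rewrite -!Lspace_piD addrA.
Qed.

Lemma Lspace_addC : commutative Lspace_add.
Proof.
by elim/Lspace_ind=> f; elim/Lspace_ind=> g; rewrite -!Lspace_piD addrC.
Qed.

Lemma Lspace_add0 : left_id Lspace_zero Lspace_add.
Proof. by elim/Lspace_ind=> f; rewrite -Lspace_piD add0r. Qed.

Lemma Lspace_addN : left_inverse Lspace_zero Lspace_opp Lspace_add.
Proof. by elim/Lspace_ind=> f; rewrite -Lspace_piN -Lspace_piD addNr. Qed.

HB.instance Definition _ := gen_eqMixin Lsp.
HB.instance Definition _ := gen_choiceMixin Lsp.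
HB.instance Definition _ := GRing.isZmodule.Build Lsp
  Lspace_addA Lspace_addC Lspace_add0 Lspace_addN.

Lemma Lspace_scaleA a b (f : Lsp) :
  Lspace_scale a (Lspace_scale b f) = Lspace_scale (a * b) f.
Proof. by elim/Lspace_ind: f => f; rewrite -!Lspace_piZ scalerA. Qed.

Lemma Lspace_scale1 : left_id 1 Lspace_scale.
Proof. by elim/Lspace_ind=> f; rewrite -Lspace_piZ scale1r. Qed.

Lemma Lspace_scaleDr : right_distributive Lspace_scale +%R.
Proof.
move=> a; elim/Lspace_ind=> f; elim/Lspace_ind=> g.
by rewrite -[Lspace_pi f + _]Lspace_piD -!Lspace_piZ scalerDr Lspace_piD.
Qed.

Lemma Lspace_scaleDl (f : Lsp) : {morph Lspace_scale^~ f : a b / a + b}.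
Proof.
by move=> a b; elim/Lspace_ind: f => f; rewrite -!Lspace_piZ scalerDl Lspace_piD.
Qed.

HB.instance Definition _ := GRing.Zmodule_isLmodule.Build R Lsp
  Lspace_scaleA Lspace_scale1 Lspace_scaleDr Lspace_scaleDl.

Definition Lspace_norm (f : Lsp) : R := fine ('N[mu]_p[EFin \o f])%E.

Lemma Lspace_norm_pi (f : Lf) :
  Lspace_norm (Lspace_pi f) = fine ('N[mu]_p[EFin \o f])%E.
Proof.
rewrite /Lspace_norm; congr fine.
exact: (ae_eq_Lnorm (measurable_funPT (Lspace_repr (Lspace_pi f)))
  (measurable_funPT f) (Lspace_piK f)).
Qed.

Lemma Lspace_normD (f g : Lsp) :
  Lspace_norm (f + g) <= Lspace_norm f + Lspace_norm g.
Proof.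
elim/Lspace_ind: f => f; elim/Lspace_ind: g => g.
by rewrite -[Lspace_pi f + _]Lspace_piD !Lspace_norm_pi; exact: ler_LnormD.
Qed.

Lemma Lspace_normZ (a : R) (f : Lsp) :
  Lspace_norm (a *: f) = `|a| * Lspace_norm f.
Proof.
elim/Lspace_ind: f => f; rewrite -[a *: Lspace_pi f]Lspace_piZ !Lspace_norm_pi.
by apply/EFin_inj; rewrite EFinM !finite_norm_fine LnormZ.
Qed.

Lemma Lspace_norm0_eq0 (f : Lsp) : Lspace_norm f = 0 -> f = 0.
Proof.
elim/Lspace_ind: f => f; rewrite Lspace_norm_pi => /fine_Lnormr_eq0 f0.
exact/Lspace_piP.
Qed.

HB.instance Definition _ := Lmodule_isNormed.Build R Lsp
  Lspace_normD Lspace_normZ Lspace_norm0_eq0.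

End Lspace_normedModType.

(* Main.v *)
Require Import Defs.
From HB Require Import structures.
From mathcomp Require Import all_boot all_order all_algebra.
From mathcomp Require Import all_classical all_reals all_analysis.
From mathcomp Require Import measurable_realfun.
From mathcomp Require Import lra ring.

Set Implicit Arguments.
Unset Strict Implicit.
Unset Printing Implicit Defensive.

Import Order.TTheory GRing.Theory Num.Theory.
Import numFieldNormedType.Exports.

Local Open Scope classical_set_scope.
Local Open Scope ring_scope.

(* The linear functionals below a sublinear [p] form a compact convex set;
   working with sublinear functionals instead of topologies, Zorn's lemma
   produces a minimal "face" of it, which is an extreme point. This yields both
   Hahn-Banach and, for every [x], an extreme point [e] of the unit ball of [X^*]
   with [e x = |x|]: the subspace spanned by the extreme points is norming.

   Let [S] be a norming subspace of [X^*] and [f] norm attaining. The seminorm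
   [p phi = sup {phi e | e in S, |e| <= 1}] on [X^**] dominates [|x|] on [X], so
   [f] extends from [X] to [X^**] below [|f| p]. By smoothness this extension is
   evaluation at [f], which therefore vanishes on the annihilator of [S]: [f] is
   in the closure of [S]. By Bishop-Phelps, [S] is dense.

   The extreme points of the unit ball of [L_1(mu)] are the normalized indicators
   of atoms, up to sign, so [L_1(mu)] is the closed span of these, an [ell_1]. *)

(** * Sublinear functionals *)

(** The endpoint of a half-line is an extreme point of it: the one-dimensional fact to which the
    midpoint arguments below reduce. *)
Lemma eq_of_le_mean (R : realFieldType) (a b c : R) :
  a <= c -> b <= c -> c *+ 2 <= a + b -> a = c.
Proof. by rewrite mulr2n; lra. Qed.

Section sublinear.
Context (R : realType) (V : lmodType R).
Implicit Types (p q : V -> R) (f g h : {linear V -> R^o}) (C : set (V * R)).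

Definition sublinear p :=
  (forall x y, p (x + y) <= p x + p y) /\
  (forall (t : R) x, 0 <= t -> p (t *: x) = t * p x).

Lemma sublinear0 p : sublinear p -> p 0 = 0.
Proof. by case=> _ /(_ 0 0 (lexx _)); rewrite scaler0 mul0r. Qed.

Lemma sublinear_leN p x : sublinear p -> - p (- x) <= p x.
Proof.
by move=> sp; have := sp.1 x (- x); rewrite subrr sublinear0//; lra.
Qed.

(** The inequality for [t^-1] at the point [t *: x] is the reverse inequality for [t], so half of
    positive homogeneity suffices. *)
Lemma sublinearP p : (forall x y, p (x + y) <= p x + p y) ->
  (forall (t : R) x, 0 < t -> p (t *: x) <= t * p x) -> p 0 = 0 -> sublinear p.
Proof.
move=> pD pZ p0; split=> // t x; rewrite le_eqVlt => /predU1P[<-|t0].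
  by rewrite scale0r mul0r.
apply/eqP; rewrite eq_le pZ//= -ler_pdivlMl//.
have ti0 : 0 < t^-1 by rewrite invr_gt0.
apply: le_trans (pZ _ (t *: x) ti0).
by rewrite scalerA mulVf ?gt_eqF// scale1r.
Qed.

(** A pair [(v, r)] in [C] stands for the constraint [f v <= r] on a linear functional [f].
    Constraints satisfied by a given [f] are stable under the cone operations. *)
Definition cone C := [/\ C (0, 0),
  forall c d, C c -> C d -> C (c + d) &
  forall (t : R) c, 0 <= t -> C c -> C (t *: c.1, t * c.2)].

(** Infimal convolution of [p] with the constraints in [C]. Under the compatibility condition [pC]
    below, it is the largest sublinear functional below [p] that satisfies these constraints. *)
Definition infconv p C z : R := inf [set p (z - c.1) + c.2 | c in C].

Section infconv.
Variables (p : V -> R) (C : set (V * R)).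
Hypotheses (sp : sublinear p) (coneC : cone C).
Hypothesis pC : forall c, C c -> 0 <= p (- c.1) + c.2.

Lemma infconv_ge z m :
  (forall c, C c -> m <= p (z - c.1) + c.2) -> m <= infconv p C z.
Proof.
move=> mC; apply: lb_le_inf; last by move=> _ [c Cc <-]; exact: mC.
by exists (p (z - 0) + 0); exists (0, 0) => //; case: coneC.
Qed.

Lemma infconv_le z c : C c -> infconv p C z <= p (z - c.1) + c.2.
Proof.
move=> Cc; apply: ge_inf; last by exists c.
(* The infimum is finite: [z - e.1] and [- z] add up to [- e.1], where [pC] bounds [p] from
   below. *)
exists (- p (- z)) => _ [e Ce <-].
have := sp.1 (z - e.1) (- z); rewrite addrAC subrr add0r.
by have := pC Ce; lra.
Qed.

Lemma infconv_le_p z : infconv p C z <= p z.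
Proof.
have C0 : C (0, 0) by case: coneC.
by have := infconv_le z C0; rewrite subr0 addr0.
Qed.

Lemma infconv_le_cone c : C c -> infconv p C c.1 <= c.2.
Proof. by move=> /(infconv_le c.1); rewrite subrr sublinear0// add0r. Qed.

Lemma le_infconv f :
  (forall x, f x <= p x) -> (forall c, C c -> f c.1 <= c.2) ->
  forall x, f x <= infconv p C x.
Proof.
move=> fp fC x; apply: infconv_ge => c Cc.
by rewrite -{1}(subrK c.1 x) linearD lerD// fC.
Qed.

Lemma infconvD (x y : V) : infconv p C (x + y) <= infconv p C x + infconv p C y.
Proof.
case: (coneC) => _ CD _.
rewrite -lerBlDr; apply: infconv_ge => c Cc; rewrite lerBlDr [leRHS]addrC -lerBlDr.
apply: infconv_ge => d Cd; rewrite lerBlDr.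
apply: le_trans (infconv_le _ (CD _ _ Cc Cd)) _.
have := sp.1 (x - c.1) (y - d.1); rewrite addrACA -opprD /= => h.
by rewrite [leRHS]addrACA; apply: lerD; rewrite [leRHS]addrC.
Qed.

Lemma infconvZ_le (t : R) (x : V) : 0 < t -> infconv p C (t *: x) <= t * infconv p C x.
Proof.
case: (coneC) => _ _ CZ t0; rewrite -ler_pdivrMl//; apply: infconv_ge => c Cc.
rewrite ler_pdivrMl//; apply: le_trans (infconv_le _ (CZ _ _ (ltW t0) Cc)) _.
by rewrite /= -scalerBr (sp.2 _ _ (ltW t0)) mulrDr.
Qed.

Lemma sublinear_infconv : sublinear (infconv p C).
Proof.
apply: sublinearP => [x y|t x t0|]; [exact: infconvD|exact: infconvZ_le|].
apply/eqP; rewrite eq_le -{1}(sublinear0 sp) infconv_le_p/=.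
by apply: infconv_ge => c /pC; rewrite sub0r.
Qed.

End infconv.

(* [infconv p (support_cone p x)] dominates exactly the linear functionals
   below [p] that agree with [p] at [x]. *)
Definition support_cone p x : set (V * R) :=
  [set (- (t *: x), - (t * p x)) | t in [set t : R | 0 <= t]].

Lemma support_coneP p x : cone (support_cone p x).
Proof.
split=> [|_ _ [t /= t0 <-] [s /= s0 <-]|s _ s0 [t /= t0 <-]].
- by exists 0 => /=; rewrite ?lexx// scale0r mul0r !oppr0.
- exists (t + s); first exact: addr_ge0.
  by rewrite scalerDl mulrDl !opprD.
- exists (s * t); first exact: mulr_ge0.
  by rewrite /= scalerN mulrN scalerA mulrA.
Qed.

Lemma support_cone_ge0 p x c : sublinear p -> support_cone p x c ->
  0 <= p (- c.1) + c.2.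
Proof. by move=> sp [t /= t0 <-]; rewrite /= opprK sp.2// subrr. Qed.

Lemma le_support_cone p x f : f x = p x ->
  forall c, support_cone p x c -> f c.1 <= c.2.
Proof. by move=> fx _ [t _ <-] /=; rewrite linearN linearZ/= fx. Qed.

Definition extreme_below p f := forall g h,
  (forall x, g x <= p x) -> (forall x, h x <= p x) ->
  (forall x, g x + h x = f x *+ 2) -> g =1 f.

(** * Faces and extreme points of the set of linear functionals below [p] *)

Section extreme.
Variable (p : V -> R).
Hypothesis sp : sublinear p.

(** Here [q] represents the set of linear functionals below it. The last clause makes this set a
    face: if it contains a midpoint, it contains the endpoints. A conclusion about [g] alone is
    enough, since [g] and [h] can be exchanged. *)
Definition face q := [/\ sublinear q, (forall x, q x <= p x) &
  forall g h, (forall x, g x <= p x) -> (forall x, h x <= p x) ->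
    (forall x, g x + h x <= q x *+ 2) -> forall x, g x <= q x].

(** The functionals below [q] that agree with [q] at [x] maximize evaluation at [x], so they form a
    face of those below [q], and a face of a face is a face. *)
Lemma face_support q x : face q -> face (infconv q (support_cone q x)).
Proof.
move=> [sq qp fq]; have cq := support_coneP q x.
have pq c : support_cone q x c -> 0 <= q (- c.1) + c.2.
  exact: support_cone_ge0.
split; first exact: sublinear_infconv.
  by move=> z; exact: le_trans (infconv_le_p sq cq pq z) (qp z).
move=> g h gp hp gh.
have ghq z : g z + h z <= q z *+ 2.
  by apply: le_trans (gh z) _; rewrite lerMn2r/= infconv_le_p.
have gq := fq _ _ gp hp ghq.
have hq : forall z, h z <= q z.
  by apply: (fq _ g) => // z; rewrite addrC.
apply: le_infconv => //; apply: le_support_cone.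
(* The constraint with [t = 1] bounds the new functional at [- x] by [- q x]. Hence the mean of
   [g x] and [h x] is at least [q x]. *)
have Cx : support_cone q x (- x, - q x).
  by exists 1; rewrite /= ?ler01// scale1r mul1r.
apply: eq_of_le_mean (gq x) (hq x) _.
rewrite -lerN2 -mulNrn opprD -!linearN; apply: le_trans (gh (- x)) _.
by rewrite lerMn2r/= (infconv_le_cone sq pq Cx).
Qed.

(** This replaces the compactness argument that a chain of nonempty faces has nonempty intersection.
    The infimum is finite because every member lies above [- p (- x)], and it is subadditive because
    the smaller of two members bounds both. *)
Lemma face_chain (A : set (V -> R)) : A !=set0 ->
  (forall q, A q -> face q) ->
  (forall q r, A q -> A r -> (forall x, q x <= r x) \/ (forall x, r x <= q x)) ->
  face (fun x => inf [set q x | q in A]).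
Proof.
move=> [q0 Aq0] Af tA; set i := fun x => _.
have ile q x : A q -> i x <= q x.
  move=> Aq; apply: ge_inf; last by exists q.
  exists (- p (- x)) => _ [r Ar <-]; have [sr rp _] := Af _ Ar.
  by apply: le_trans (sublinear_leN x sr); rewrite lerN2.
have ige m x : (forall q, A q -> m <= q x) -> m <= i x.
  move=> mA; apply: lb_le_inf; first by exists (q0 x); exists q0.
  by move=> _ [q Aq <-]; exact: mA.
split; [apply: sublinearP| |].
- move=> x y; rewrite -lerBlDr; apply: (ige) => q Aq.
  rewrite lerBlDr [leRHS]addrC -lerBlDr; apply: (ige) => r Ar; rewrite lerBlDr.
  have [[sq _ _] [sr _ _]] := (Af _ Aq, Af _ Ar).
  have [qr|rq] := tA _ _ Aq Ar.
    apply: le_trans (ile _ _ Aq) _; apply: le_trans (sq.1 _ _) _.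
    by rewrite addrC lerD.
  apply: le_trans (ile _ _ Ar) _; apply: le_trans (sr.1 _ _) _.
  by rewrite addrC lerD.
- move=> t x t0; rewrite -ler_pdivrMl//; apply: (ige) => q Aq.
  have [[_ qZ] _ _] := Af _ Aq.
  by rewrite ler_pdivrMl// -(qZ _ _ (ltW t0)) ile.
- have [sq0 _ _] := Af _ Aq0; apply/eqP; rewrite eq_le.
  rewrite -{1}(sublinear0 sq0) ile//=; apply: (ige) => q Aq.
  by have [sq _ _] := Af _ Aq; rewrite sublinear0.
- by move=> x; have [_ qp _] := Af _ Aq0; exact: le_trans (ile _ _ Aq0) (qp x).
- move=> g h gp hp gh x; apply: (ige) => q Aq; have [_ _ fq] := Af _ Aq.
  by apply: (fq g h) => // z; apply: le_trans (gh z) _; rewrite lerMn2r/= ile.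
Qed.

Lemma face_self : face p.
Proof. by split=> // g h gp. Qed.

Lemma exists_minimal_face :
  exists2 q, face q & forall r, face r -> (forall x, r x <= q x) ->
    forall x, q x <= r x.
Proof.
pose T := {q : V -> R | face q}.
(* The order is reversed: Zorn's lemma provides maximal elements, and a minimal face is wanted. *)
pose le (s t : T) := `[< forall x, sval t x <= sval s x >].
have le_refl t : le t t by apply/asboolP.
have le_tr r s t : le r s -> le s t -> le r t.
  by move=> /asboolP rs /asboolP st; apply/asboolP => x; exact: le_trans (rs x).
have [A totA|[q fq] qmin] := ZL_preorder (exist _ p face_self : T) le_refl le_tr.
  have [[s0 As0]|] := pselect (A !=set0); last first.
    move=> A0; exists (exist _ p face_self) => s As.
    by case: A0; exists s.
  pose B := [set sval s | s in A].
  have fB : face (fun x => inf [set q x | q in B]).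
    apply: face_chain => [|_ [s _ <-]|_ _ [s As <-] [t At <-]].
    - by exists (sval s0); exists s0.
    - exact: (svalP s).
    - by have [/asboolP|/asboolP] := totA _ _ As At; [right|left].
  exists (exist _ _ fB) => s As; apply/asboolP => x /=; apply: ge_inf.
    exists (- p (- x)) => _ [_ [t At <-] <-]; have [sr rp _] := svalP t.
    by apply: le_trans (sublinear_leN x sr); rewrite lerN2.
  by exists (sval s) => //; exists s.
exists q => // r fr rq.
have /asboolP// : le (exist _ r fr) (exist _ q fq).
by apply: qmin; apply/asboolP.
Qed.

(* A minimal face is linear: minimality forces [q] to equal its own
   [infconv q (support_cone q x)], whence [q (- x) <= - q x]. *)
Lemma exists_extreme_below :
  exists2 f : {linear V -> R^o}, (forall x, f x <= p x) & extreme_below p f.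
Proof.
have [q [sq qp fq] qmin] := exists_minimal_face.
have fQ : face q by [].
have qN x : q (- x) = - q x.
  apply/eqP; rewrite eq_le; apply/andP; split; last first.
    by have := sublinear_leN x sq; rewrite lerNl.
  have cq := support_coneP q x.
  have pq c : support_cone q x c -> 0 <= q (- c.1) + c.2.
    exact: support_cone_ge0.
  apply: le_trans (qmin _ (face_support x fQ) (infconv_le_p sq cq pq) (- x)) _.
  have Cx : support_cone q x (- x, - q x).
    by exists 1; rewrite /= ?ler01// scale1r mul1r.
  exact: (infconv_le_cone sq pq Cx).
have qD x y : q (x + y) = q x + q y.
  apply/eqP; rewrite eq_le sq.1/=.
  by have := sq.1 (x + y) (- y); rewrite addrK qN; lra.
have qZ t x : q (t *: x) = t * q x.
  have [t0|/ltW t0] := leP 0 t; first exact: sq.2.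
  rewrite -[t]opprK scaleNr qN sq.2 ?oppr_ge0//.
  by rewrite !mulNr.
have lq : linear (q : V -> R^o) by move=> t x y; rewrite qD qZ.
pose f : {linear V -> R^o} :=
  HB.pack (q : V -> R^o) (GRing.isLinear.Build _ _ _ _ _ lq).
exists f => // g h gp hp gh.
have gq x : g x <= q x by apply: (fq g h) => // z; rewrite gh.
have hq x : h x <= q x by apply: (fq h g) => // z; rewrite addrC gh.
by move=> x; apply: eq_of_le_mean (gq x) (hq x) _; rewrite gh.
Qed.
End extreme.

(** Mazur-Orlicz form of the Hahn-Banach theorem: every linear functional below [infconv p C] lies
    below [p] and satisfies the constraints. *)
Lemma sandwich p C : sublinear p -> cone C ->
  (forall c, C c -> 0 <= p (- c.1) + c.2) ->
  exists2 f : {linear V -> R^o}, (forall x, f x <= p x) & forall c, C c -> f c.1 <= c.2.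
Proof.
move=> sp coneC pC.
have [f fp _] := exists_extreme_below (sublinear_infconv sp coneC pC).
exists f => [x|c Cc]; first exact: le_trans (fp x) (infconv_le_p sp coneC pC x).
exact: le_trans (fp _) (infconv_le_cone sp pC Cc).
Qed.

(** An extreme point of the face of functionals supporting [p] at [x] is extreme among all
    functionals below [p]: if it is the midpoint of [g] and [h], then both support [p] at [x] and
    lie in that face. *)
Lemma exists_extreme_support p x : sublinear p ->
  exists f : {linear V -> R^o}, [/\ (forall y, f y <= p y), f x = p x & extreme_below p f].
Proof.
move=> sp; have coneC := support_coneP p x.
have pC c : support_cone p x c -> 0 <= p (- c.1) + c.2 by exact: support_cone_ge0.
have [f fP ef] := exists_extreme_below (sublinear_infconv sp coneC pC).
have fp y : f y <= p y by exact: le_trans (fP y) (infconv_le_p sp coneC pC y).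
have fx : f x = p x.
  apply/eqP; rewrite eq_le fp/=.
  have Cx : support_cone p x (- x, - p x).
    by exists 1; rewrite /= ?ler01// scale1r mul1r.
  have := le_trans (fP _) (infconv_le_cone sp pC Cx).
  by rewrite /= linearN lerN2.
exists f; split=> // g h gp hp gh.
have gx : g x = p x.
  by apply: eq_of_le_mean (gp x) (hp x) _; rewrite -fx -gh.
have hx : h x = p x.
  by apply: eq_of_le_mean (hp x) (gp x) _; rewrite -fx -gh [leRHS]addrC.
by apply: (ef g h) => //; apply: le_infconv => //; exact: le_support_cone.
Qed.

End sublinear.

(** * Duals of normed spaces and the Bishop-Phelps theorem *)

Section duality.
Context (R : realType) (V : normedModType R).

Lemma sublinear_normr k : 0 <= k -> sublinear (fun x : V => k * `|x|).
Proof.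
move=> k0; split=> [x y|t x t0]; first by rewrite -mulrDr ler_wpM2l// ler_normD.
by rewrite normrZ ger0_norm// mulrCA.
Qed.

Lemma dual_space_of (f : {linear V -> R^o}) M : 0 <= M ->
  (forall x, f x <= M * `|x|) ->
  exists2 F : dual_space V, F =1 f & `|F| <= M.
Proof.
move=> M0 fM.
have fM' x : `|f x| <= M * `|x|.
  by rewrite ler_norml lerNl -linearN fM -normrN fM.
have fP : (f : V -> R^o) \in @bounded_functional R V.
  apply/asboolP; split; first exact: linearP.
  apply: (bounded_linear_continuous (f := f)); apply/bounded_funP => r.
  by exists (M * r) => x xr; apply: le_trans (fM' x) _; rewrite ler_wpM2l.
exists (DualSpace fP) => //; apply: dual_norm_leP => x x1.
by apply: le_trans (fM' x) _; rewrite ler_piMr.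
Qed.

Lemma dual_le (f : dual_space V) (x : V) : f x <= `|f| * `|x|.
Proof. exact: le_trans (ler_norm _) (dual_norm_le f x). Qed.

Lemma dual_eqP (f g : dual_space V) : f =1 g <-> f = g.
Proof. by split=> [fg|->//]; apply/val_inj/funext. Qed.

Definition extreme_unit_ball (W : normedModType R) (e : W) :=
  `|e| <= 1 /\ forall g h : W, `|g| <= 1 -> `|h| <= 1 -> g + h = e *+ 2 -> g = e.

(** The unit ball of the dual consists of the linear functionals below the norm, so an extreme
    functional supporting the norm at [x] is the required one. *)
Lemma extreme_norming (x : V) :
  exists2 e : dual_space V, extreme_unit_ball e & e x = `|x|.
Proof.
have [e [e1 ex ee]] := exists_extreme_support x (sublinear_normr ler01).
have [E Ee E1] := dual_space_of ler01 e1.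
exists E; last by rewrite Ee ex mul1r.
have le1 (g : dual_space V) : `|g| <= 1 -> forall y, g y <= 1 * `|y|.
  by move=> g1 y; apply: le_trans (dual_le g y) _; rewrite ler_wpM2r.
split=> // g h g1 h1 gh; apply/dual_eqP => y; rewrite Ee.
apply: (ee g h) => //; [exact: le1|exact: le1|].
by move=> z; rewrite -Ee -[RHS]/((E *+ 2) z) -gh.
Qed.

Lemma eq0_of_le_mul (a C : R) (e : nat -> R) : 0 <= C ->
  (forall k : R, 0 < k -> exists n, e n < k) -> (forall n, `|a| <= e n * C) -> a = 0.
Proof.
move=> C0 e0 aC; apply/eqP/negPn/negP; rewrite -normr_gt0 => a0.
move: C0; rewrite le_eqVlt => /predU1P[C0|C0].
  by have := aC 0; rewrite -C0 mulr0 leNgt a0.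
have [n] := e0 _ (divr_gt0 a0 C0).
by rewrite ltr_pdivlMr// ltNge aC.
Qed.

(* The limit at [x] is the common point of the intervals of radius [e n * `|x|]
   around [g n x], which pairwise meet. *)
Lemma dual_space_complete (g : nat -> dual_space V) (e : nat -> R) :
  (forall k : R, 0 < k -> exists n, e n < k) ->
  (forall m n, `|g m - g n| <= e m + e n) ->
  exists h : dual_space V, forall n, `|h - g n| <= e n.
Proof.
move=> e0 ge; have e_ge0 n : 0 <= e n.
  by have := le_trans (normr_ge0 _) (ge n n); rewrite -mulr2n pmulrn_lge0.
have gex m n x : `|g m x - g n x : R| <= (e m + e n) * `|x|.
  by apply: le_trans (dual_norm_le (g m - g n) x) _; rewrite ler_wpM2r// ge.
pose G x : R := inf [set (g n x : R) + e n * `|x| | n in [set: nat]].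
have lbG m x : (g m x : R) - e m * `|x| <= G x.
  apply: lb_le_inf; first by exists ((g 0%N x : R) + e 0%N * `|x|), 0%N.
  move=> _ [n _ <-]; have := gex m n x; rewrite ler_norml => /andP[_].
  by move: (g m x : R) (g n x : R) => u v; lra.
have ubG m x : G x <= (g m x : R) + e m * `|x|.
  apply: ge_inf; last by exists m.
  exists ((g 0%N x : R) - e 0%N * `|x|) => _ [n _ <-].
  have := gex 0%N n x; rewrite ler_norml => /andP[_].
  by move: (g 0%N x : R) (g n x : R) => u v; lra.
have Gg m x : `|G x - (g m x : R)| <= e m * `|x|.
  have := lbG m x; have := ubG m x; rewrite ler_norml.
  by move: (g m x : R) => u ? ?; lra.
have lG : linear (G : V -> R^o).
  move=> k x y; apply/eqP; rewrite -subr_eq0; apply/eqP.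
  apply: (@eq0_of_le_mul _ (`|k *: x + y| + `|k| * `|x| + `|y|) e) => // n.
  (* As [g n] is linear, the linearity defect of [G] equals that of [G - g n], which is at most
     [e n] times a constant independent of [n]. *)
  have -> : G (k *: x + y) - (k *: (G x : R^o) + G y) =
    (G (k *: x + y) - (g n (k *: x + y) : R))
    - k * (G x - (g n x : R)) - (G y - (g n y : R)).
    have real (a b c u v : R) :
      a - (k * b + c) = (a - (k * u + v)) - k * (b - u) - (c - v) by ring.
    by rewrite [g n (_ + _)]linearP; exact: real.
  rewrite ![e n * (_ + _)]mulrDr; apply: le_trans (ler_normB _ _) _; apply: lerD => //.
  apply: le_trans (ler_normB _ _) _; apply: lerD => //.
  by rewrite normrM mulrCA ler_wpM2l.
pose F : {linear V -> R^o} :=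
  HB.pack (G : V -> R^o) (GRing.isLinear.Build _ _ _ _ _ lG).
have C0 : 0 <= `|g 0%N| + e 0%N by rewrite addr_ge0.
have [|H HG H1] := @dual_space_of F _ C0.
  move=> x; apply: le_trans (ubG 0%N x) _.
  by rewrite mulrDl lerD2r dual_le.
exists H => n; apply: dual_norm_leP => x x1.
rewrite -[(H - g n) x]/((H x : R) - (g n x : R)) HG.
by apply: le_trans (Gg n x) _; rewrite ler_piMr.
Qed.

End duality.

(** * The Bishop-Phelps theorem: density of the norm attaining functionals *)

Section Bishop_Phelps.
Context (R : realType) (X : completeNormedModType R).
Implicit Type f : dual_space X.

(** Ekeland's variational principle on the unit ball. Order the ball by letting [t] lie above [s]
    when [f] gains at least [k] times their distance. Along a chain [f] is increasing and bounded,
    so the chain is Cauchy and its limit is an upper bound; Zorn's lemma then yields [x0]. *)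
Lemma exists_ball_maximal f (k : R) : 0 < k ->
  exists2 x0 : X, `|x0| <= 1 &
    forall x, `|x| <= 1 -> f (x - x0) <= k * `|x - x0|.
Proof.
move=> k0; pose T := {x : X | `|x| <= 1}.
pose le (s t : T) := k * `|sval t - sval s| <= (f (sval t) : R) - f (sval s).
have le_refl t : le t t by rewrite /le !subrr normr0 mulr0.
have le_tr r s t : le r s -> le s t -> le r t.
  rewrite /le => rs st; apply: le_trans (_ : k * (`|sval t - sval s| + `|sval s - sval r|) <= _).
    by rewrite ler_wpM2l ?(ltW k0)// ler_distD.
  by move: rs st; move: (f _ : R) (f _ : R) (f _ : R) => a b c; lra.
have B0 : `|0 : X| <= 1 by rewrite normr0.
have [A totA|[x0 x01] x0max] := ZL_preorder (exist _ 0 B0 : T) le_refl le_tr.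
  have [[a0 Aa0]|] := pselect (A !=set0); last first.
    by move=> A0; exists (exist _ 0 B0) => s As; case: A0; exists s.
  pose fA := [set (f (sval a) : R) | a in A]; pose s := sup fA.
  have fA_sup : has_sup fA.
    split; first by exists (f (sval a0)), a0.
    exists `|f| => _ [a Aa <-]; apply: le_trans (dual_le f (sval a)) _.
    by rewrite ler_piMr// (svalP a).
  have fs a : A a -> (f (sval a) : R) <= s.
    by move=> Aa; apply: ub_le_sup; [exact: fA_sup.2|exists a].
  have dist a b : A a -> A b ->
      k * `|sval a - sval b| <= `|(f (sval a) : R) - f (sval b)|.
    move=> Aa Ab; have [|] := totA _ _ Aa Ab; rewrite /le => /le_trans ab.
      by rewrite [`|sval a - _|]distrC [leRHS]distrC; apply/ab/ler_norm.
    exact/ab/ler_norm.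
  (* The tails of the chain: its members with [f]-value within [e] of the supremum [s]. *)
  pose F := filter_from [set e : R | 0 < e]
    (fun e => [set x : X | exists a, [/\ A a, sval a = x & s - e < f x]]).
  have FF : ProperFilter F.
    apply: filter_from_proper; first apply: filter_from_filter.
    - by exists 1 => /=.
    - move=> d e d0 e0; exists (Num.min d e); first by rewrite /= lt_min d0.
      move=> x [a [Aa ax sx]]; split; exists a; split => //;
        apply: le_lt_trans sx; rewrite lerD2l lerN2 ge_min lexx ?orbT//.
    - move=> e e0; have [_ [a Aa <-] sa] := sup_adherent e0 fA_sup.
      by exists (sval a), a.
  have : cvg F.
    apply: cauchy_cvg; apply: cauchy_exP => e e0.
    (* By [dist], values within [k * e] of the supremum force distances below [e]. *)
    have ke0 : 0 < k * e by exact: mulr_gt0.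
    have [_ [a Aa <-] sa] := sup_adherent ke0 fA_sup.
    exists (sval a), (k * e) => // _ [b [Ab <- sb]].
    rewrite -ball_normE /ball_/= -(ltr_pM2l k0).
    apply: le_lt_trans (dist _ _ Aa Ab) _; have := fs _ Aa; have := fs _ Ab.
    move: sa sb; rewrite -/s ltr_norml.
    by move: (f (sval a) : R) (f (sval b) : R) => u v; lra.
  move=> /cvg_ex[y Fy].
  have near_y e : 0 < e ->
      exists b, [/\ A b, `|y - sval b| < e & s - e < f (sval b)].
    move=> e0; have Fe : F [set x : X | exists a, [/\ A a, sval a = x & s - e < f x]].
      by exists e.
    have /fcvgrPdist_lt/(_ _ e0) Fye := Fy.
    by have [x [[b [Ab <- sb]] yb]] := filter_ex (filterI Fe Fye); exists b.
  have y1 : `|y| <= 1.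
    apply/ler_addgt0Pr => e /near_y[b [_ yb _]].
    rewrite -[y](subrK (sval b)) addrC; apply: le_trans (ler_normD _ _) _.
    exact: lerD (svalP b) (ltW yb).
  (* The error [e] is split into multiples of [d]: one [d] for [s] against [f (sval b)], one for
     [fba], [|f| * d] for replacing [f y] by [f (sval b)], and [k * d] for replacing [y] by [sval b]
     in the distance. *)
  have C0 : 0 < 2 + `|f| + k by rewrite addr_gt0// ltr_pwDl.
  exists (exist _ y y1) => a Aa; rewrite /le/=; apply/ler_addgt0Pr => e e0.
  have [b [Ab yb sb]] := near_y _ (divr_gt0 e0 C0).
  set d := e / _ in yb sb; have -> : e = 2 * d + `|f| * d + k * d.
    by rewrite -!mulrDl mulrC divfK ?gt_eqF.
  have fy : (f (sval b) : R) <= f y + `|f| * d.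
    rewrite -lerBlDl.
    have /= := dual_le f (sval b - y); rewrite [f _]linearB => /le_trans; apply.
    by rewrite distrC ler_wpM2l// ltW.
  have ya : k * `|y - sval a| <= k * d + k * `|sval b - sval a|.
    rewrite -mulrDr ler_wpM2l ?(ltW k0)//.
    apply: le_trans (ler_distD (sval b) _ _) _.
    by rewrite lerD2r ltW.
  have fba : `|(f (sval b) : R) - f (sval a)| <= s - f (sval a) + d.
    have := fs _ Aa; have := fs _ Ab; rewrite ler_norml; move: sb.
    have : 0 < d by exact: divr_gt0.
    by move: (f (sval a) : R) (f (sval b) : R) => u v; lra.
  have := dist _ _ Ab Aa; move: ya fba fy sb.
  by move: (f (sval a) : R) (f (sval b) : R) (f y : R) `|_ : R| => u v w z; lra.
(* A point violating the inequality lies above [x0]; by maximality [x0] also lies above it, so [f]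
   would have to gain in both directions. *)
exists x0 => // x x1; rewrite leNgt; apply/negP => fx.
have : le (exist _ x x1) (exist _ x0 x01).
  by apply: x0max; rewrite /le/= ltW//; move: fx; rewrite linearB.
rewrite /le/= distrC => ?; move: fx; rewrite linearB.
move: (f x : R) (f x0 : R) => a b; have := mulr_ge0 (ltW k0) (normr_ge0 (x - x0)); lra.
Qed.

(** Write [g] as [f + L] with [L] below [k] times the norm and below [- f] on the differences
    [w - x0], where [w] runs over the unit ball. Then [f + L] is maximal over the ball at [x0]. The
    choice of [x0] is exactly the compatibility condition of [sandwich]. *)
Lemma Bishop_Phelps f (k : R) : 0 < k ->
  exists2 g : dual_space X, attains_norm g & `|f - g| <= k.
Proof.
move=> k0; have [x0 x01 fx0] := exists_ball_maximal f k0.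
(* The cone generated by the ball translated by [- x0], with [t] the scaling factor; each constraint
   bounds the functional by [- f]. *)
pose C : set (X * R) :=
  [set c | exists (t : R) (w : X), [/\ 0 <= t, `|w| <= t & c = (w - t *: x0, - f (w - t *: x0))]].
have coneC : cone C.
  split.
  - by exists 0, 0; rewrite normr0 scale0r subr0 linear0 oppr0.
  - move=> _ _ [t [v [t0 vt ->]]] [s [w [s0 ws ->]]].
    exists (t + s), (v + w); split; first exact: addr_ge0.
      by apply: le_trans (ler_normD _ _) _; exact: lerD.
    have -> : v + w - (t + s) *: x0 = v - t *: x0 + (w - s *: x0).
      by rewrite scalerDl opprD addrACA.
    rewrite [f (_ + (w - _))]linearD; exact/(congr1 (pair _))/esym/opprD.
  - move=> s _ s0 [t [w [t0 wt ->]]]; exists (s * t), (s *: w); split.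
    + exact: mulr_ge0.
    + by rewrite normrZ ger0_norm// ler_wpM2l.
    + by rewrite -scalerA -scalerBr [f (s *: _)]linearZ /= mulrN.
have pC c : C c -> 0 <= k * `|- c.1| + c.2.
  move=> [t [w [t0 wt ->]]]; rewrite /= normrN subr_ge0.
  move: t0; rewrite le_eqVlt => /predU1P[t0|t0].
    move: wt; rewrite -t0 normr_le0 => /eqP ->.
    by rewrite scale0r subr0 linear0 normr0 mulr0.
  have -> : w - t *: x0 = t *: (t^-1 *: w - x0).
    by rewrite scalerBr scalerA divff ?gt_eqF// scale1r.
  rewrite linearZ normrZ (gtr0_norm t0) mulrCA ler_pM2l//; apply: fx0.
  by rewrite normrZ gtr0_norm ?invr_gt0// mulrC ler_pdivrMr// mul1r.
have [l lk lC] := sandwich (sublinear_normr X (ltW k0)) coneC pC.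
have [L Ll L1] := dual_space_of (ltW k0) lk.
have gx w : `|w| <= 1 -> (f + L) w <= (f + L) x0.
  move=> w1; have : C (w - x0, - f (w - x0)).
    by exists 1, w; rewrite scale1r ler01.
  have real (a b c d : R) : a - b <= - (c - d) -> c + a <= d + b by lra.
  by move=> /lC /=; rewrite -Ll [L _]linearB [f _]linearB => /real.
exists (f + L); last by rewrite opprD addNKr normrN.
(* The ball is symmetric, so the maximum of [f + L] over it is the norm of [f + L]. *)
exists x0 => //; apply/eqP; rewrite eq_le; apply/andP; split.
  by apply: le_trans (dual_norm_le _ _) _; rewrite ler_piMr// dual_norm_ge0.
apply: dual_norm_leP => w w1; apply: le_trans (ler_norm _).
by rewrite ler_norml lerNl -linearN !gx// normrN.
Qed.
End Bishop_Phelps.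

(** * Weak Hahn-Banach smoothness and norming subspaces *)

Section weakly_Hahn_Banach_smooth.
Context (R : realType).

Lemma bidual_embeddingD (V : normedModType R) (x y : V) :
  bidual_embedding (x + y) = bidual_embedding x + bidual_embedding y.
Proof. by apply/dual_eqP => f; exact: linearD. Qed.

Lemma bidual_embeddingZ (V : normedModType R) (k : R) (x : V) :
  bidual_embedding (k *: x) = k *: bidual_embedding x.
Proof. by apply/dual_eqP => f; exact: linearZ. Qed.

Lemma bidual_embedding_norm_le (V : normedModType R) (x : V) :
  `|bidual_embedding x| <= `|x|.
Proof.
by apply: dual_norm_leP => g g1; apply: le_trans (dual_norm_le g x) _; rewrite ler_piMl.
Qed.

(** The canonical embedding is a contraction, so an extension cannot have smaller norm than [f];
    only the upper bound remains to be checked for the extensions below. *)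
Lemma extension_norm_ge (X : normedModType R) (f : dual_space X)
    (F : dual_space (dual_space (dual_space X))) :
  (forall x, F (bidual_embedding x) = f x) -> `|f| <= `|F|.
Proof.
move=> Ff; apply: dual_norm_leP => x x1; rewrite -Ff.
apply: le_trans (dual_norm_le _ _) _; rewrite ler_piMr// ?dual_norm_ge0//.
exact: le_trans (bidual_embedding_norm_le x) x1.
Qed.

Definition sup_ball (V : normedModType R) (S : set V) (phi : dual_space V) : R :=
  sup [set (phi e : R) | e in [set e | S e /\ `|e| <= 1]].

Section sup_ball.
Variables (V : normedModType R) (S : set V).
Hypothesis S0 : S 0.

Let has_sup_ball (phi : dual_space V) :
  has_sup [set (phi e : R) | e in [set e | S e /\ `|e| <= 1]].
Proof.
split; first by exists (phi 0), 0; rewrite //= normr0.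
exists `|phi| => _ [e [_ e1] <-]; apply: le_trans (dual_le _ _) _.
by rewrite ler_piMr.
Qed.

Lemma sup_ball_ge (phi : dual_space V) e :
  S e -> `|e| <= 1 -> phi e <= sup_ball S phi.
Proof. by move=> Se e1; apply: ub_le_sup; [exact: (has_sup_ball phi).2|exists e]. Qed.

Lemma sup_ball_le (phi : dual_space V) m :
  (forall e, S e -> `|e| <= 1 -> phi e <= m) -> sup_ball S phi <= m.
Proof.
move=> pm; apply: sup_le_ub; first exact: (has_sup_ball phi).1.
by move=> _ [e [Se e1] <-]; exact: pm.
Qed.

Lemma sublinear_sup_ball : sublinear (sup_ball S).
Proof.
apply: sublinearP => [phi psi|t phi t0|].
- apply: sup_ball_le => e Se e1.
  exact: lerD (sup_ball_ge _ Se e1) (sup_ball_ge _ Se e1).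
- apply: sup_ball_le => e Se e1; rewrite -[leLHS]/(t * (phi e : R)).
  by rewrite ler_wpM2l ?(ltW t0)// sup_ball_ge.
- apply/eqP; rewrite eq_le sup_ball_le//= -[leLHS]/((0 : dual_space V) 0 : R).
  by rewrite sup_ball_ge// normr0.
Qed.
End sup_ball.

Variable (X : completeNormedModType R) (S : set (dual_space X)).
Hypotheses (S0 : S 0) (SD : forall f g, S f -> S g -> S (f + g)).
Hypothesis SZ : forall (k : R) f, S f -> S (k *: f).
Hypothesis S_norming :
  forall x : X, exists2 e : dual_space X, S e /\ `|e| <= 1 & e x = `|x|.

Lemma attains_norm_le_sup_ball (f : dual_space X) :
  weakly_Hahn_Banach_smooth X -> attains_norm f ->
  forall phi : dual_space (dual_space X), phi f <= `|f| * sup_ball S phi.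
Proof.
move=> smoothX /smoothX [F0 [_ F0u]].
pose q phi := `|f| * sup_ball S phi.
have sq : sublinear q.
  split=> [phi psi|t phi t0]; first by rewrite -mulrDr ler_wpM2l// (sublinear_sup_ball S0).1.
  by rewrite /q (sublinear_sup_ball S0).2// mulrCA.
(* These upper bounds, taken at [x] and at [- x], force a functional to extend [f]. *)
pose C : set (dual_space (dual_space X) * R) :=
  [set (bidual_embedding x, f x : R) | x in [set: X]].
have coneC : cone C.
  split.
  - exists 0 => //; congr pair; last exact: linear0.
    by apply/dual_eqP => g; exact: linear0.
  - move=> _ _ [x _ <-] [y _ <-]; exists (x + y) => //.
    by rewrite bidual_embeddingD [f _]linearD.
  - move=> t _ _ [x _ <-]; exists (t *: x) => //.
    by rewrite bidual_embeddingZ [f _]linearZ.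
(* An element of [S] norming [- x] shows that [sup_ball S] is at least [|x|] at the image of [- x],
   so [q] dominates [f] there. *)
have qC c : C c -> 0 <= q (- c.1) + c.2.
  move=> [x _ <-] /=; have [e [Se e1] ex] := S_norming (- x).
  have : `|x| <= sup_ball S (- bidual_embedding x).
    rewrite -normrN -ex; have -> : e (- x) = (- bidual_embedding x) e.
      exact: linearN.
    exact: sup_ball_ge.
  move=> xp; have := dual_le f (- x); rewrite [f _]linearN normrN lerNl -subr_ge0.
  move/le_trans; apply; rewrite opprK addrC lerD2r.
  by rewrite ler_wpM2l.
have [G Gq GC] := sandwich sq coneC qC.
have GM (phi : dual_space (dual_space X)) : G phi <= `|f| * `|phi|.
  apply: le_trans (Gq phi) _; rewrite ler_wpM2l//; apply: (sup_ball_le S0) => e Se e1.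
  by apply: le_trans (dual_le _ _) _; rewrite ler_piMr.
have [F FG F1] := dual_space_of (normr_ge0 f) GM.
have Ff x : F (bidual_embedding x) = f x.
  apply/eqP; rewrite FG eq_le; apply/andP; split.
    by apply: (GC (_, _)); exists x.
  have : C (bidual_embedding (- x), f (- x)) by exists (- x).
  move=> /GC /=; rewrite -scaleN1r bidual_embeddingZ !scaleN1r.
  by rewrite [f _]linearN [G _]linearN lerN2.
(* Both [F] and evaluation at [f] are norm-preserving extensions, so they coincide, and the bound on
   [F] becomes a bound on [phi f]. *)
have eF : norm_preserving_extension f F.
  split=> //; apply/eqP; rewrite eq_le F1/=; exact: extension_norm_ge.
have ef : norm_preserving_extension f (bidual_embedding f).
  split=> //; apply/eqP; rewrite eq_le bidual_embedding_norm_le/=.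
  exact: extension_norm_ge.
move=> phi; have : bidual_embedding f = F by rewrite -(F0u _ eF) -(F0u _ ef).
by move=> /dual_eqP/(_ phi) /= ->; rewrite FG; exact: Gq.
Qed.

Lemma norming_subspace_dense : weakly_Hahn_Banach_smooth X ->
  forall (f : dual_space X) (k : R), 0 < k -> exists2 s, S s & `|f - s| < k.
Proof.
move=> smoothX.
pose C : set (dual_space X * R) := [set (s, 0) | s in S].
have coneC : cone C.
  split; first by exists 0.
    by move=> _ _ [s Ss <-] [t St <-]; exists (s + t); [exact: SD|congr pair; rewrite addr0].
  by move=> t _ _ [s Ss <-]; exists (t *: s); [exact: SZ|rewrite /= mulr0].
have n1 := sublinear_normr (dual_space X) (@ler01 R).
have nC c : C c -> 0 <= 1 * `|- c.1| + c.2.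
  by move=> [s Ss <-] /=; rewrite addr0 mul1r.
(* The distance to [S]. A functional supporting [D] at a norm attaining [f] is nonpositive on [S],
   so [sup_ball S] is nonpositive at it, and the previous lemma gives [D f <= 0]. *)
pose D := infconv (fun f : dual_space X => 1 * `|f|) C.
have near_attains (f : dual_space X) : attains_norm f -> D f <= 0.
  move=> af; have [phi [phiD phif _]] :=
    exists_extreme_support f (sublinear_infconv n1 coneC nC).
  have phi1 x : phi x <= 1 * `|x|.
    exact: le_trans (phiD x) (infconv_le_p n1 coneC nC x).
  have [Phi Phiphi _] := dual_space_of ler01 phi1.
  rewrite -[D f]phif -Phiphi; apply: le_trans (attains_norm_le_sup_ball smoothX af Phi) _.
  rewrite mulr_ge0_le0//; apply: (sup_ball_le S0) => e Se _; rewrite Phiphi.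
  by apply: le_trans (phiD e) (infconv_le_cone n1 nC (c := (e, 0)) _); exists e.
move=> f k k0; have k2 : 0 < k / 2 by rewrite divr_gt0.
have [g ag fg] := Bishop_Phelps f k2.
have [s Ss gs] : exists2 s, S s & `|g - s| < k / 2.
  apply: contrapT => noS; have := near_attains _ ag; rewrite leNgt => /negP; apply.
  apply: lt_le_trans k2 _; apply: infconv_ge => // _ [s Ss <-] /=.
  by rewrite mul1r addr0 leNgt; apply/negP => gs; apply: noS; exists s.
exists s => //; rewrite [k]splitr.
by apply: le_lt_trans (ler_distD g _ _) _; rewrite ler_ltD.
Qed.
End weakly_Hahn_Banach_smooth.

(** * Preduals of ell1 *)

Section ell1_seq.
Context (R : realType) (I : choiceType).

Lemma esum_le_seq (b : I -> R) M :
  (forall s : seq I, uniq s -> \sum_(i <- s) b i <= M) ->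
  (\esum_(i in [set: I]) (b i)%:E <= M%:E)%E.
Proof.
move=> bM; apply: ge_ereal_sup => _ [A [finA _] <-].
by rewrite fsbig_finite//= sumEFin lee_fin bM// finmap.fset_uniq.
Qed.

Implicit Type c : ell1 R I.

Lemma ell1_sum_le c (s : seq I) : uniq s -> \sum_(i <- s) `|c i : R| <= `|c|.
Proof.
move=> us; rewrite -lee_fin [(`|c|)%:E]ell1_normE; apply: esum_ge.
exists [set` s]; first by split => //; exact: finite_seq.
by rewrite -fsbig_seq// sumEFin.
Qed.

Lemma ell1_norm_le_seq c M :
  (forall s : seq I, uniq s -> \sum_(i <- s) `|c i : R| <= M) -> `|c| <= M.
Proof.
by move=> cM; rewrite -lee_fin [(`|c|)%:E]ell1_normE; exact: esum_le_seq.
Qed.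

Lemma ell1_sum_approx c (e : R) : 0 < e ->
  exists2 s : seq I, uniq s & `|c| - e < \sum_(i <- s) `|c i : R|.
Proof.
move=> e0; apply: contrapT => noS.
have /ell1_norm_le_seq : forall s : seq I, uniq s ->
    \sum_(i <- s) `|c i : R| <= `|c| - e.
  by move=> s us; rewrite leNgt; apply/negP => ce; apply: noS; exists s.
by rewrite leNgt ltrBlDr ltrDl e0.
Qed.

Lemma ell1_of (b : I -> R) M :
  (forall s : seq I, uniq s -> \sum_(i <- s) `|b i| <= M) ->
  exists c, c =1 b.
Proof.
move=> bM; suff cP : (b : I -> R^o) \in @absolutely_summable R I.
  by exists (Ell1 cP).
apply/asboolP; apply: (@le_lt_trans _ _ M%:E); last exact: ltry.
exact: (esum_le_seq (b := fun i => `|b i|)).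
Qed.
End ell1_seq.

(* [a] is a basis of a subspace of [X^*] isometric to [ell1], [t] its coordinate
   functionals, extended to all of [X^*] in such a way that the coordinate map
   remains a contraction. *)
Section ell1_dual.
Context (R : realType) (X : completeNormedModType R) (I : choiceType).
Variables (a : I -> dual_space X) (t : I -> {linear dual_space X -> R^o}).
Hypothesis a_le1 : forall i, `|a i| <= 1.
Hypothesis ta : forall i j, t i (a j) = (i == j)%:R.
Hypothesis t_sum : forall (s : seq I) f, uniq s ->
  \sum_(i <- s) `|t i f : R| <= `|f|.

(** The linear span of the [a i]. Asking for the expansion over every large enough finite family
    lets two elements be expanded over a common one. *)
Definition finite_expansion : set (dual_space X) := [set f | exists s : seq I,
  forall s', uniq s' -> {subset s <= s'} -> f = \sum_(i <- s') (t i f : R) *: a i].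

Lemma finite_expansion0 : finite_expansion 0.
Proof.
by exists [::] => s' _ _; rewrite big1// => i _; rewrite linear0 scale0r.
Qed.

Lemma finite_expansionD f g :
  finite_expansion f -> finite_expansion g -> finite_expansion (f + g).
Proof.
move=> [s sf] [s' sg]; exists (s ++ s') => u uu su.
have su1 : {subset s <= u} by move=> i si; rewrite su// mem_cat si.
have su2 : {subset s' <= u} by move=> i si; rewrite su// mem_cat si orbT.
rewrite {1}(sf _ uu su1) {1}(sg _ uu su2) -big_split/=.
by apply: eq_bigr => i _; rewrite -scalerDl linearD.
Qed.

Lemma finite_expansionZ (k : R) f : finite_expansion f -> finite_expansion (k *: f).
Proof.
move=> [s sf]; exists s => u uu su; rewrite {1}(sf _ uu su) scaler_sumr.
by apply: eq_bigr => i _; rewrite scalerA linearZ.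
Qed.

Let tZa (k : R) i j : (t i (k *: a j) : R) = k * (i == j)%:R.
Proof. by rewrite -ta linearZ. Qed.

Lemma finite_expansion_a i : finite_expansion (a i).
Proof.
exists [:: i] => u uu iu; rewrite (bigD1_seq i)//=; last by rewrite iu// inE.
rewrite ta eqxx scale1r big1 ?addr0// => j ji.
by rewrite ta (negbTE ji) scale0r.
Qed.

Lemma norm_sum_a_le (s : seq I) (k : I -> R) :
  `|\sum_(i <- s) k i *: a i| <= \sum_(i <- s) `|k i|.
Proof.
apply: le_trans (ler_norm_sum _ _ _) _; apply: ler_sum => i _.
by rewrite normrZ ler_piMr.
Qed.

(** Together with [t_sum], this makes the coordinate map isometric on the span of the [a i]. *)
Lemma norm_finite_expansion f : finite_expansion f ->
  exists2 s : seq I, uniq s & `|f| <= \sum_(i <- s) `|t i f : R|.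
Proof.
move=> [s sf]; exists (undup s); first exact: undup_uniq.
have us := undup_uniq s.
have ss : {subset s <= undup s} by move=> i; rewrite mem_undup.
by rewrite {1}(sf _ us ss) norm_sum_a_le.
Qed.

Lemma coordinates_exist f : exists c : ell1 R I, forall i, c i = t i f.
Proof. by apply: ell1_of => s us; exact: t_sum us. Qed.

Definition coordinates f : ell1 R I := sval (cid (coordinates_exist f)).

Lemma coordinatesE f i : coordinates f i = t i f.
Proof. by rewrite /coordinates; case: cid. Qed.

Lemma coordinates_linear : linear coordinates.
Proof.
move=> k f g; apply/val_inj/funext => i.
rewrite -[LHS]/(coordinates (k *: f + g) i).
rewrite -[RHS]/(k *: coordinates f i + coordinates g i) !coordinatesE.
exact: linearP.
Qed.

Lemma coordinates_norm_le f : `|coordinates f| <= `|f|.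
Proof.
apply: ell1_norm_le_seq => s us; under eq_bigr do rewrite coordinatesE.
exact: t_sum.
Qed.

(** The preimage is the sum of the series of the [c i *: a i]. Its finite partial sums are Cauchy
    because [|a i| <= 1], and coordinates pass to the limit because each [t i] is a contraction. *)
Lemma coordinates_surj (c : ell1 R I) : exists f, coordinates f = c.
Proof.
pose e (n : nat) : R := n.+1%:R^-1.
have e_gt0 n : 0 < e n by rewrite invr_gt0.
have e0 (k : R) : 0 < k -> exists n, e n < k.
  move=> k0; exists (Num.truncn k^-1).
  by rewrite -ltf_pV2 ?posrE// invrK Num.Theory.truncnS_gt.
have /choice[s sP] n : exists s : seq I,
    uniq s /\ `|c| - e n < \sum_(i <- s) `|c i : R|.
  by have [s us cs] := ell1_sum_approx c (e_gt0 n); exists s.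
pose g n := \sum_(i <- s n) (c i : R) *: a i.
have g_le n (u : seq I) : uniq u -> {subset s n <= u} ->
    `|\sum_(i <- u) (c i : R) *: a i - g n| <= e n.
  move=> uu su; have [us cs] := sP n.
  (* Stated for any module, to be applied both to the vectors [c i *: a i] and to the reals
     [|c i|]. *)
  have eg (V : lmodType R) (F : I -> V) : \sum_(i <- u) F i - \sum_(i <- s n) F i =
      \sum_(i <- [seq i <- u | i \notin s n]) F i.
    apply/eqP; rewrite subr_eq addrC.
    rewrite (bigID (fun i => i \in s n))/= big_filter; apply/eqP; congr (_ + _).
    rewrite -big_filter; apply: perm_big; apply: uniq_perm => //.
      exact: filter_uniq.
    by move=> i; rewrite mem_filter; case: (boolP (i \in s n)) => // /su ->.
  rewrite /g eg; apply: le_trans (norm_sum_a_le _ _) _.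
  rewrite -(eg R^o (fun i => `|c i : R|)).
  by have := ell1_sum_le c uu; move: cs; lra.
have gg m n : `|g m - g n| <= e m + e n.
  pose u := undup (s m ++ s n); have uu : uniq u := undup_uniq _.
  apply: le_trans (ler_distD (\sum_(i <- u) (c i : R) *: a i) _ _) _.
  rewrite distrC lerD// g_le// => i; rewrite mem_undup mem_cat => -> //.
  by rewrite orbT.
have [f fg] := dual_space_complete e0 gg.
exists f; apply/val_inj/funext => i; apply/eqP.
rewrite -[X in X == _]/(coordinates f i) -subr_eq0 coordinatesE; apply/eqP.
(* The factor 2 counts one error [e n] for passing from [f] to [g n] and one for passing from the
   coordinate of [g n] to [c i]. *)
apply: (@eq0_of_le_mul _ _ 2 e) => // n.
have tg : `|(t i (g n) : R) - c i| <= e n.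
  have [us cs] := sP n; rewrite linear_sum.
  have [si|si] := boolP (i \in s n).
    rewrite (bigD1_seq i)//= tZa eqxx big1 ?addr0 => [|j ji].
      by rewrite mulr1 subrr normr0 ltW.
    by rewrite tZa eq_sym (negbTE ji) mulr0.
  (* Outside [s n] the coordinate of [g n] vanishes, and [|c i|] is part of the tail that [s n]
     leaves out. *)
  rewrite big_seq big1 ?sub0r ?normrN => [|j js].
    have : uniq (i :: s n) by rewrite /= si.
    by move/(ell1_sum_le c); rewrite big_cons; move: cs; lra.
  rewrite tZa; have [ij|_] := eqVneq i j; last by rewrite mulr0.
  by rewrite ij js in si.
have tf : `|(t i f : R) - t i (g n)| <= e n.
  have := @t_sum [:: i] (f - g n) isT; rewrite big_seq1 [t i _]linearB.
  by move/le_trans; apply.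
apply: le_trans (ler_distD (t i (g n) : R) _ _) _.
by rewrite mulr_natr mulr2n lerD.
Qed.

(** The extreme points lie in the span of the [a i], which is therefore norming, hence dense. The
    coordinate map is a contraction, isometric on this dense span, so it is isometric everywhere. *)
Lemma dual_iso_ell1 : weakly_Hahn_Banach_smooth X ->
  (forall e : dual_space X, extreme_unit_ball e ->
    e = 0 \/ exists i (k : R), e = k *: a i) ->
  isometrically_isomorphic (dual_space X) (ell1 R I).
Proof.
move=> smoothX extX.
have norming (x : X) :
    exists2 e : dual_space X, finite_expansion e /\ `|e| <= 1 & e x = `|x|.
  have [e ee ex] := extreme_norming x; exists e => //; split; last exact: ee.1.
  have [->|[i [k ->]]] := extX _ ee; first exact: finite_expansion0.
  exact/finite_expansionZ/finite_expansion_a.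
have dense := norming_subspace_dense finite_expansion0 finite_expansionD
  finite_expansionZ norming smoothX.
pose T : {linear dual_space X -> ell1 R I} :=
  HB.pack coordinates (GRing.isLinear.Build _ _ _ _ _ coordinates_linear).
have T_isom f : `|T f| = `|f|.
  apply/eqP; rewrite eq_le coordinates_norm_le/=; apply/ler_addgt0Pr => e e0.
  have e2 : 0 < e / 2 by rewrite divr_gt0.
  have [s Ss fs] := dense f _ e2.
  have sT : `|s| <= `|T s|.
    have [u uu su] := norm_finite_expansion Ss.
    apply: le_trans su _; under eq_bigr do rewrite -coordinatesE.
    exact: ell1_sum_le.
  have Ts : `|T s| <= `|T f| + `|f - s|.
    rewrite -lerBlDl; apply: le_trans (lerB_dist _ _) _.
    by rewrite -linearB distrC coordinates_norm_le.
  have : `|f| <= `|f - s| + `|s| by rewrite -{1}(subrK s f) ler_normD.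
  by move: sT Ts fs; lra.
exists T => //; rewrite -setTT_bijective; split=> //.
  move=> f g _ _ fg.
  by apply/eqP; rewrite -subr_eq0 -normr_eq0 -T_isom linearB fg subrr normr0.
by move=> c _; have [f fc] := coordinates_surj c; exists f.
Qed.
End ell1_dual.

(** * The space L1 *)

Section L1_functions.
Context (R : realType) (d : measure_display) (T : measurableType d).
Variable mu : {measure set T -> \bar R}.
Local Notation L1 := (LspaceType1 mu).
Implicit Types (g h : L1) (f : T -> R) (A B D : set T).

Lemma L1_integrable g : mu.-integrable [set: T] (EFin \o (g : T -> R)).
Proof. by apply/Lfun1_integrable; exact: Lspace_LfunP. Qed.

Lemma L1_integrableS g D : measurable D -> mu.-integrable D (EFin \o (g : T -> R)).
Proof. by move=> mD; apply: integrableS (L1_integrable g). Qed.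

Lemma L1_eq g h : (g : T -> R) = h %[ae mu] -> g = h.
Proof.
by move=> gh; rewrite -(Lspace_reprK g) -(Lspace_reprK h); apply/Lspace_piP.
Qed.

Lemma L1_of f : mu.-integrable [set: T] (EFin \o f) ->
  exists g, (g : T -> R) = f %[ae mu].
Proof.
by move=> /Lfun1_integrable fP; exists (Lspace_pi (Lfun_Sub (lexx _) fP)); exact: Lspace_piK.
Qed.

Lemma L1_norm g : `|g| = \int[mu]_x `|g x|.
Proof. by rewrite -[LHS]/(fine _) Lnorm1. Qed.

Lemma L1D g h : ((g + h : L1) : T -> R) = (fun x => g x + h x) %[ae mu].
Proof. exact: (Lspace_piK (Lspace_repr g + Lspace_repr h)). Qed.

Lemma L1Z (k : R) g : ((k *: g : L1) : T -> R) = (fun x => k * g x) %[ae mu].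
Proof. exact: (Lspace_piK (k *: Lspace_repr g)). Qed.

Lemma L1_0 : ((0 : L1) : T -> R) = cst 0 %[ae mu].
Proof. exact: (Lspace_piK 0). Qed.

Lemma ae_eq_Rintegral D f f' : measurable D ->
  measurable_fun D f -> measurable_fun D f' -> f = f' %[ae mu] ->
  \int[mu]_(x in D) f x = \int[mu]_(x in D) f' x.
Proof.
move=> mD mf mf' ff'; congr fine; apply: ae_eq_integral => //.
- exact/measurable_EFinP.
- exact/measurable_EFinP.
- by apply: filterS ff' => x /(_ I) /= ->.
Qed.

Lemma L1_measurable g D : measurable D -> measurable_fun D (g : T -> R).
Proof. by move=> mD; apply/measurable_EFinP; exact: measurable_int (L1_integrableS g mD). Qed.

Lemma L1_int_linear D : measurable D ->
  linear (fun g => \int[mu]_(x in D) g x : R^o).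
Proof.
move=> mD k g h.
rewrite (@ae_eq_Rintegral _ _ (fun x => k * g x + h x)) //; first last.
- have := L1D (k *: g) h; have := L1Z k g.
  by apply: filterS2 => x /(_ I) kg /(_ I) /= ->; rewrite kg.
- apply: measurable_funD; last exact: L1_measurable.
  by apply: measurable_funM => //; exact: L1_measurable.
- exact: L1_measurable.
rewrite RintegralD//; last exact: L1_integrableS.
  by rewrite RintegralZl//; exact: L1_integrableS.
have := integrableZl mD k (L1_integrableS g mD).
by apply: eq_integrable.
Qed.

(** By induction, removing [F i] from [D] and from the remaining sets; their integrals do not change
    because the overlaps are null. *)
Lemma sum_integral_le (I : eqType) (s : seq I) (F : I -> set T) D (f : T -> \bar R) :
  uniq s -> measurable D -> (forall i, measurable (F i)) ->
  (forall i, i \in s -> F i `<=` D) ->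
  (forall i j, i \in s -> j \in s -> i != j -> mu (F i `&` F j) = 0) ->
  measurable_fun D f -> (forall x, D x -> 0 <= f x)%E ->
  (\sum_(i <- s) \int[mu]_(x in F i) f x <= \int[mu]_(x in D) f x)%E.
Proof.
elim: s F D => [|i s IHs] F D us mD mF FD F0 mf f0.
  by rewrite big_nil; exact: integral_ge0.
move: us => /= /andP[si us]; rewrite big_cons.
have FiD : F i `<=` D by apply: FD; rewrite inE eqxx.
have mDF : measurable (D `\` F i) by exact: measurableD.
rewrite -(setDUK FiD) ge0_integral_setU//; first last.
- by apply/disj_setPS => x [? []].
- by rewrite setDUK.
- by rewrite setDUK.
apply: leeD2l.
rewrite big_seq (eq_bigr (fun j => \int[mu]_(x in F j `\` F i) f x)%E) => [|j js].
  rewrite -big_seq; apply: (IHs (fun j => F j `\` F i)) => //.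
  - by move=> j; exact: measurableD.
  - by move=> j js x [Fx nFx]; split=> //; apply: (FD j) => //; rewrite inE js orbT.
  - move=> j k js ks jk; apply: (@subset_measure0 _ _ _ mu _ (F j `&` F k)) => //.
    + by apply: measurableI; exact: measurableD.
    + exact: measurableI.
    + by move=> x [[? ?] [? ?]].
    + by apply: F0 => //; rewrite inE (js, ks) orbT.
  - by apply: measurable_funS mf => // x [].
  - by move=> x [/f0].
have jD : F j `<=` D by apply: FD; rewrite inE js orbT.
rewrite (@ge0_negligible_integral _ _ _ mu (F j) (F i `&` F j))//.
- by rewrite setDIr setDv setU0.
- exact: measurableI.
- exact: measurable_funS mf.
- by move=> x /jD /f0.
- by apply: F0; rewrite ?inE ?eqxx ?js ?orbT//; apply: contraNneq si => ->.
Qed.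

(** Applied to the atoms, this is the condition [t_sum] on the coordinate functionals. *)
Lemma L1_int_sum_le (I : eqType) (s : seq I) (F : I -> set T) g :
  uniq s -> (forall i, measurable (F i)) ->
  (forall i j, i != j -> mu (F i `&` F j) = 0%E) ->
  \sum_(i <- s) `|\int[mu]_(x in F i) g x| <= `|g|.
Proof.
move=> us mF F0; rewrite L1_norm.
apply: (@le_trans _ _ (\sum_(i <- s) \int[mu]_(x in F i) `|g x|)).
  apply: ler_sum => i _; apply: le_normr_Rintegral => //.
  exact: L1_integrableS.
have ig D : measurable D -> mu.-integrable D (fun x => `|g x|%:E).
  by move=> mD; exact: integrable_norm (L1_integrableS g mD).
rewrite -lee_fin -sumEFin.
under eq_bigr do rewrite /Rintegral fineK ?integrable_fin_num ?ig//.
rewrite /Rintegral fineK ?integrable_fin_num ?ig//.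
apply: sum_integral_le => //; first by move=> i j _ _; exact: F0.
exact: measurable_int (ig _ measurableT).
Qed.
End L1_functions.

(** * Atoms and extreme points of the unit ball of L1 *)

Section atoms.
Context (R : realType) (d : measure_display) (T : measurableType d).
Variable mu : {measure set T -> \bar R}.
Local Notation L1 := (LspaceType1 mu).
Implicit Types (g h : L1) (f u : T -> R) (A B D : set T).

(** Only atoms of finite measure carry nonzero integrable functions. *)
Definition finite_atom A := [/\ measurable A, (0 < mu A)%E, (mu A < +oo)%E &
  forall B, measurable B -> mu (A `&` B) = 0%E \/ mu (A `\` B) = 0%E].

Definition null_equiv A B := mu (A `\` B) = 0%E /\ mu (B `\` A) = 0%E.

Lemma null_equiv_refl A : null_equiv A A.
Proof. by rewrite /null_equiv setDv measure0. Qed.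

Lemma null_equiv_sym A B : null_equiv A B -> null_equiv B A.
Proof. by case. Qed.

Lemma null_subset_trans A B D : measurable A -> measurable B -> measurable D ->
  mu (A `\` B) = 0%E -> mu (B `\` D) = 0%E -> mu (A `\` D) = 0%E.
Proof.
move=> mA mB mD AB BD.
apply: (@subset_measure0 _ _ _ mu _ ((A `\` B) `|` (B `\` D))).
- exact: measurableD.
- by apply: measurableU; exact: measurableD.
- by move=> x [Ax nDx]; have [Bx|nBx] := pselect (B x); [right|left].
- by apply: null_set_setU => //; exact: measurableD.
Qed.

Lemma null_equiv_trans A B D : measurable A -> measurable B -> measurable D ->
  null_equiv A B -> null_equiv B D -> null_equiv A D.
Proof.
move=> mA mB mD [AB BA] [BD DB]; split.
  exact: null_subset_trans AB BD.
exact: null_subset_trans DB BA.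
Qed.

Definition atom_rep A : set T :=
  xget set0 [set B | finite_atom B /\ null_equiv A B].

Lemma atom_repP A : finite_atom A ->
  finite_atom (atom_rep A) /\ null_equiv A (atom_rep A).
Proof.
move=> aA; apply: (@xgetI _ set0 [set B | finite_atom B /\ null_equiv A B] A).
by split=> //; exact: null_equiv_refl.
Qed.

(** Equivalent atoms have the same set of candidate representatives, and the choice depends on that
    set alone. *)
Lemma eq_atom_rep A B : finite_atom A -> finite_atom B -> null_equiv A B ->
  atom_rep A = atom_rep B.
Proof.
move=> aA aB AB; rewrite /atom_rep; congr xget; apply/seteqP.
have [[mA _ _ _] [mB _ _ _]] := (aA, aB).
split=> D [aD AD]; split=> //; have [mD _ _ _] := aD.
  exact: null_equiv_trans (null_equiv_sym AB) AD.
exact: null_equiv_trans AB AD.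
Qed.

(* One representative of each class of atoms modulo null sets. *)
Definition atom_index := {A : set T | `[< finite_atom A /\ atom_rep A = A >]}.
Implicit Types i j : atom_index.

Lemma atom_indexP i : finite_atom (val i).
Proof. by have /asboolP[] := valP i. Qed.

Lemma atom_index_measurable i : measurable (val i).
Proof. by case: (atom_indexP i). Qed.

(** Two atoms with non-null intersection contain each other up to null sets, so they share their
    representative. *)
Lemma atom_index_disjoint i j : i != j -> mu (val i `&` val j) = 0%E.
Proof.
move=> ij; have [[mA A0 _ dA] [mB B0 _ dB]] := (atom_indexP i, atom_indexP j).
have [//|AB] := dA _ mB.
have [|BA] := dB _ mA; first by rewrite setIC.
have /asboolP[_ ri] := valP i; have /asboolP[_ rj] := valP j.
case/eqP: ij; apply/val_inj; rewrite -ri -rj.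
by apply: eq_atom_rep; [exact: atom_indexP|exact: atom_indexP|split].
Qed.

Lemma integrable_scale_indic (k : R) A : measurable A -> (mu A < +oo)%E ->
  mu.-integrable [set: T] (EFin \o (fun x => k * \1_A x)).
Proof.
move=> mA Afin.
have iA : mu.-integrable [set: T] (EFin \o (\1_A : T -> R)).
  apply/integrableP; split; first exact/measurable_EFinP.
  rewrite (eq_integral (fun x => (\1_A x)%:E)) ?integral_indic ?setIT//.
  by move=> x _ /=; rewrite ger0_norm.
by have := integrableZl measurableT k iA; apply: eq_integrable.
Qed.

Definition atom_fun i : T -> R := fun x => (fine (mu (val i)))^-1 * \1_(val i) x.

Lemma atom_elt_exists i : exists g, (g : T -> R) = atom_fun i %[ae mu].
Proof.
have [mA _ Afin _] := atom_indexP i.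
exact: L1_of (integrable_scale_indic _ mA Afin).
Qed.

Definition atom_elt i : L1 := sval (cid (atom_elt_exists i)).

Lemma atom_eltE i : (atom_elt i : T -> R) = atom_fun i %[ae mu].
Proof. exact: svalP (cid (atom_elt_exists i)). Qed.

Lemma measurable_atom_fun i D : measurable D -> measurable_fun D (atom_fun i).
Proof.
move=> mD; apply: measurable_funM => //.
by apply: measurable_funTS; exact: measurable_indic (atom_index_measurable i).
Qed.

Lemma atom_mu_gt0 i : 0 < fine (mu (val i)).
Proof. by have [_ A0 Afin _] := atom_indexP i; rewrite fine_gt0// A0. Qed.

Lemma int_atom_fun D i : measurable D ->
  \int[mu]_(x in D) atom_fun i x = (fine (mu (val i)))^-1 * fine (mu (val i `&` D)).
Proof.
move=> mD; have [mA _ Afin _] := atom_indexP i.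
have iA : mu.-integrable D (EFin \o (\1_(val i) : T -> R)).
  apply: (@integrableS _ _ _ mu setT) => //.
  have := integrable_scale_indic 1 mA Afin.
  by apply: eq_integrable => // x _; rewrite /= mul1r.
by rewrite RintegralZl// /Rintegral integral_indic.
Qed.

Lemma int_atom_elt i j :
  \int[mu]_(x in val i) (atom_elt j x) = (i == j)%:R.
Proof.
have mi := atom_index_measurable i.
rewrite (ae_eq_Rintegral mi (L1_measurable _ mi) (measurable_atom_fun j mi)
  (atom_eltE j)) int_atom_fun//.
have [->|ij] := eqVneq i j; first by rewrite setIid mulVf// gt_eqF// atom_mu_gt0.
by rewrite atom_index_disjoint 1?eq_sym// mulr0.
Qed.

Lemma norm_atom_elt i : `|atom_elt i| = 1.
Proof.
rewrite L1_norm (@ae_eq_Rintegral _ _ _ _ _ _ (atom_fun i))//; first last.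
- apply: filterS (atom_eltE i) => x /(_ I) /= -> _.
  by rewrite ger0_norm// mulr_ge0// invr_ge0 ltW// atom_mu_gt0.
- exact: measurable_atom_fun.
- by apply: measurableT_comp => //; exact: L1_measurable.
by rewrite int_atom_fun// setIT mulVf// gt_eqF// atom_mu_gt0.
Qed.

Lemma integrable_mul_bounded f u (M : R) :
  mu.-integrable [set: T] (EFin \o f) -> measurable_fun [set: T] u ->
  (forall x, `|u x| <= M) -> mu.-integrable [set: T] (EFin \o (fun x => f x * u x)).
Proof.
move=> intf mu_ uM; have iMf := integrableZl measurableT M intf.
have mf : measurable_fun [set: T] f.
  by apply/measurable_EFinP; exact: measurable_int intf.
apply: le_integrable iMf => //.
  by apply/measurable_EFinP; exact: measurable_funM.
move=> x _; rewrite /= lee_fin normrM mulrC normrM ler_wpM2r//.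
exact: le_trans (uM x) (ler_norm M).
Qed.

(** The factor is nonnegative because [|u x - k| <= 2] and [|s| <= 2^-1]. The correction
    [s * (u x - k)] has integral zero against [|g|], so the norm is unchanged. *)
Lemma norm_mul_centered g u (k s : R) :
  measurable_fun [set: T] u -> (forall x, `|u x| <= 1) ->
  `|k| <= 1 -> `|s| <= 2^-1 -> \int[mu]_x (`|g x| * u x) = k * `|g| ->
  exists2 h : L1, (h : T -> R) = (fun x => g x * (1 + s * (u x - k))) %[ae mu] &
    `|h| = `|g|.
Proof.
move=> mu_ u1 k1 s1 uk.
pose v x := 1 + s * (u x - k).
have suk x : `|s * (u x - k)| <= 1.
  rewrite normrM; apply: (@le_trans _ _ (2^-1 * 2)); last by rewrite mulVf.
  apply: ler_pM => //; apply: le_trans (ler_normB _ _) _.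
  by rewrite (_ : 2 = 1 + 1)//; exact: lerD.
have mv : measurable_fun [set: T] v.
  apply: measurable_funD => //; apply: measurable_funM => //.
  exact: measurable_funB.
have v0 x : 0 <= v x.
  by have := suk x; rewrite ler_norml /v => /andP[]; lra.
have v2 x : `|v x| <= 2.
  by rewrite ger0_norm//; have := suk x; rewrite ler_norml /v => /andP[]; lra.
have igv := integrable_mul_bounded (L1_integrable g) mv v2.
have [h hE] := L1_of igv; exists h => //.
have iag : mu.-integrable [set: T] (EFin \o (fun x => `|g x|)).
  exact: integrable_norm (L1_integrable g).
have iagu := integrable_mul_bounded iag mu_ u1.
have iagk : mu.-integrable [set: T] (EFin \o (fun x => k * `|g x|)).
  by have := integrableZl measurableT k iag; apply: eq_integrable.
have iB : mu.-integrable [set: T] (EFin \o (fun x => `|g x| * u x - k * `|g x|)).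
  by have := integrableB measurableT iagu iagk; apply: eq_integrable.
have isB : mu.-integrable [set: T]
    (EFin \o (fun x => s * (`|g x| * u x - k * `|g x|))).
  by have := integrableZl measurableT s iB; apply: eq_integrable.
rewrite L1_norm (@ae_eq_Rintegral _ _ _ _ _ _
  (fun x => `|g x| + s * (`|g x| * u x - k * `|g x|)))//; first last.
- apply: filterS hE => x /(_ I) -> _; rewrite normrM (ger0_norm (v0 x)).
  by rewrite /v; ring.
- apply/measurable_EFinP.
  have := integrableD measurableT iag isB.
  by move=> /(@measurable_int _ _ _ _ _ _); apply: eq_measurable_fun.
- by apply: measurableT_comp => //; exact: L1_measurable.
rewrite RintegralD// RintegralZl// RintegralB// RintegralZl// uk -L1_norm.
by rewrite subrr mulr0 addr0.
Qed.

(** Let [k] be the mean of [u] for the weight [|g|]. The perturbations of [g] with [s = 2^-1] and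
    [s = - 2^-1] have the norm of [g] and midpoint [g], so extremality makes [g * (u - k)] vanish
    almost everywhere. *)
Lemma extreme_mul_bounded g u : extreme_unit_ball g -> g != 0 ->
  measurable_fun [set: T] u -> (forall x, `|u x| <= 1) ->
  exists2 k, `|k| <= 1 & (fun x => g x * u x) = (fun x => k * g x) %[ae mu].
Proof.
move=> [g1 ge] g0 mu_ u1.
have N0 : 0 < `|g| by rewrite normr_gt0.
have iag : mu.-integrable [set: T] (EFin \o (fun x => `|g x|)).
  exact: integrable_norm (L1_integrable g).
have iagu := integrable_mul_bounded iag mu_ u1.
pose k := (\int[mu]_x (`|g x| * u x)) / `|g|.
have k1 : `|k| <= 1.
  rewrite normrM normfV normr_id ler_pdivrMr// mul1r L1_norm.
  apply: le_trans (le_normr_Rintegral _ iagu) _ => //.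
  apply: le_Rintegral => //; first exact: integrable_norm iagu.
  by move=> x _; rewrite normrM normr_id ler_piMr.
have uk : \int[mu]_x (`|g x| * u x) = k * `|g| by rewrite divfK// gt_eqF.
have s1 : `|2^-1| <= 2^-1 :> R by rewrite ger0_norm// invr_ge0.
have s2 : `|- 2^-1| <= 2^-1 :> R by rewrite normrN.
have [h1 h1E h1n] := norm_mul_centered mu_ u1 k1 s1 uk.
have [h2 h2E h2n] := norm_mul_centered mu_ u1 k1 s2 uk.
have hg : h1 = g.
  apply: (ge h1 h2); [by rewrite h1n|by rewrite h2n|].
  have hh : (fun x => h1 x + h2 x) = (fun x => g x + g x) %[ae mu].
    by move: h1E h2E; apply: filterS2 => x /(_ I) -> /(_ I) -> _; field.
  rewrite mulr2n; apply: L1_eq.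
  have := L1D g g; have := L1D h1 h2; move: hh.
  by apply: filterS3 => x /(_ I) hgx /(_ I) -> /(_ I) -> _.
exists k => //; apply: filterS h1E => x /(_ I); rewrite hg => gx _.
suff : 2^-1 * (g x * u x - k * g x) = 0.
  by move/eqP; rewrite mulf_eq0 invr_eq0 pnatr_eq0/= subr_eq0 => /eqP.
by rewrite -(subrr (g x)) [X in _ = X - _]gx; ring.
Qed.

(** A bounded injective test function on the line; continuity makes its composition with [g]
    measurable. *)
Lemma continuous_squash : continuous (fun t : R => t / (1 + `|t|)).
Proof.
move=> t; apply: cvgM; first exact: cvg_id.
apply: cvgV; first by rewrite gt_eqF// ltr_pwDl.
by apply: cvgD; [exact: cvg_cst|exact: norm_continuous].
Qed.

Lemma squash_inj (t : R) : let k := t / (1 + `|t|) in t = k / (1 - `|k|).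
Proof.
have t1 : 1 + `|t| != 0 by rewrite gt_eqF// ltr_pwDl.
rewrite /= normrM normfV (ger0_norm (_ : 0 <= 1 + `|t|)) ?addr_ge0//.
have -> : 1 - `|t| / (1 + `|t|) = (1 + `|t|)^-1 by field.
by rewrite invrK mulfVK.
Qed.

Lemma null_equiv_indic A B : measurable A -> measurable B -> null_equiv A B ->
  (\1_A : T -> R) = \1_B %[ae mu].
Proof.
move=> mA mB [AB BA]; exists ((A `\` B) `|` (B `\` A)); split.
- by apply: measurableU; exact: measurableD.
- by apply: null_set_setU => //; exact: measurableD.
move=> x /= nx; apply: contrapT => /not_orP[nAB nBA]; apply: nx => _.
rewrite !indicE; congr (_%:R); congr nat_of_bool; apply/idP/idP; rewrite !inE => xAB.
  by apply: contrapT => nB; apply: nAB.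
by apply: contrapT => nB; apply: nBA.
Qed.

(* Testing extremality against a bounded injective function of [g] shows that [g]
   takes a single nonzero value; testing it against indicators shows that its
   support is an atom. *)
Lemma extreme_atom g : extreme_unit_ball g ->
  g = 0 \/ exists i (k : R), g = k *: atom_elt i.
Proof.
move=> eg; have [->|g0] := eqVneq g 0; [by left|right].
have mg : measurable_fun [set: T] (g : T -> R) by exact: L1_measurable.
have [k _ gk] : exists2 k, `|k| <= 1 &
    (fun x => g x * (g x / (1 + `|g x|))) = (fun x => k * g x) %[ae mu].
  apply: (extreme_mul_bounded eg g0 (u := fun x => g x / (1 + `|g x|))).
    apply: measurableT_comp (continuous_measurable_fun continuous_squash) mg.
  move=> x; rewrite normrM normfV (ger0_norm (_ : 0 <= 1 + `|g x|)) ?addr_ge0//.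
  by rewrite ler_pdivrMr ?ltr_pwDl// mul1r lerDr.
(* By [squash_inj], the only value whose squashed image is [k]. *)
pose c := k / (1 - `|k|); pose A := [set x | g x != 0].
have mA : measurable A.
  have -> : A = [set: T] `&` (g : T -> R) @^-1` (~` [set 0]).
    by apply/seteqP; split=> x /=; [move=> /eqP gx; split|case=> _ /eqP].
  by apply: mg => //; exact: measurableC.
have gA : (g : T -> R) = (fun x => c * \1_A x) %[ae mu].
  apply: filterS gk => x /(_ I) /= gx _; rewrite indicE.
  have [xA|xA] := boolP (x \in A); last first.
    by rewrite mulr0; apply/eqP/negPn; apply: contraNN xA; rewrite inE.
  rewrite mulr1 [LHS]squash_inj /=; move: xA; rewrite inE /A /= => gx0.
  suff -> : g x / (1 + `|g x|) = k by [].
  by apply: (mulfI gx0); rewrite gx mulrC.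
have gN0 : ~ (g : T -> R) = cst 0 %[ae mu].
  move=> gz; move/eqP: g0; apply; apply: L1_eq.
  by have := L1_0 mu; move: gz; apply: filterS2 => x /(_ I) -> /(_ I) ->.
have c0 : c != 0.
  apply: contra_notN gN0 => /eqP cz; apply: filterS gA => x /(_ I) -> _.
  by rewrite cz mul0r.
have Apos : (0 < mu A)%E.
  rewrite lt0e measure_ge0 andbT; apply: contra_notN gN0 => /eqP A0.
  exists A; split=> // x /= gx; apply/eqP => gz; apply: gx => _; exact: gz.
have Afin : (mu A < +oo)%E.
  have := L1_integrable g => /integrableP[_].
  rewrite (@ge0_ae_eq_integral _ _ _ mu _ _ (fun x => `|c|%:E * (\1_A x)%:E)%E)//.
  - rewrite ge0_integralZl_EFin//; last exact/measurable_EFinP.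
    rewrite integral_indic// setIT.
    have := leey (mu A); rewrite le_eqVlt => /predU1P[->|//].
    by rewrite gt0_muley// lte_fin normr_gt0.
  - apply: measurableT_comp => //; exact/measurable_EFinP.
  - by apply: measurable_funeM; exact/measurable_EFinP.
  - apply: filterS gA => x /(_ I) gx _; rewrite /= gx normrM EFinM.
    by rewrite [`|\1_A x|]ger0_norm.
have aA : finite_atom A.
  split=> // B mB.
  (* On [A] the function [g] cancels, leaving [\1_B] equal to [l] almost everywhere: [l = 1] makes
     the part of [A] outside [B] null, any other [l] the part inside. *)
  have [l _ gl] : exists2 l, `|l| <= 1 &
      (fun x => g x * \1_B x) = (fun x => l * g x) %[ae mu].
    apply: (extreme_mul_bounded eg g0 (u := \1_B)); first exact: measurable_indic.
    by move=> x; rewrite ger0_norm// indicE; case: (_ \in _).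
  have [l1|l1] := eqVneq l 1; [right|left]; (apply: measure_negligible;
      [by [exact: measurableD|exact: measurableI]|]); apply: negligibleS gl => x.
    move=> [/= gx nB] /(_ I); rewrite indicE memNset// mulr0 l1 mul1r => /esym/eqP.
    by rewrite (negbTE gx).
  move=> [/= gx xB] /(_ I); rewrite indicE mem_set// mulr1 => /esym/eqP.
  by rewrite -subr_eq0 -{2}[g x]mul1r -mulrBl mulf_eq0 subr_eq0 (negbTE l1) (negbTE gx).
have [arA eA] := atom_repP aA.
have iP : `[< finite_atom (atom_rep A) /\ atom_rep (atom_rep A) = atom_rep A >].
  by apply/asboolP; split=> //; exact/esym/eq_atom_rep.
(* Passing from the support to its representative changes the indicator only on a null set; the
   coefficient [c * fine (mu (val i))] undoes the normalization of [atom_fun]. *)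
pose i : atom_index := exist _ (atom_rep A) iP.
exists i, (c * fine (mu (val i))); apply: L1_eq.
have [mrA _ _ _] := arA; have eAi := null_equiv_indic mA mrA eA.
have := L1Z (c * fine (mu (val i))) (atom_elt i).
have gi : (g : T -> R) = (fun x => c * fine (mu (val i)) * atom_fun i x) %[ae mu].
  move: gA eAi; apply: filterS2 => x /(_ I) -> /(_ I) -> _.
  by rewrite /atom_fun mulrA mulfK// gt_eqF// atom_mu_gt0.
move: gi (atom_eltE i).
by apply: filterS3 => x /(_ I) -> /(_ I) <- /(_ I) ->.
Qed.
End atoms.

(** * Symmetry and transitivity of isometric isomorphism *)

Section isometries.
Context (R : realType).
Implicit Types U V W : normedModType R.

Lemma isometrically_isomorphic_sym V W :
  isometrically_isomorphic V W -> isometrically_isomorphic W V.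
Proof.
move=> [J [K JK KJ] Jn].
pose K' : {linear W -> V} :=
  HB.pack K (GRing.isLinear.Build _ _ _ _ K (can2_linear JK KJ)).
exists K'; first by exists J.
by move=> x; rewrite -Jn KJ.
Qed.

Lemma isometrically_isomorphic_trans U V W :
  isometrically_isomorphic U V -> isometrically_isomorphic V W ->
  isometrically_isomorphic U W.
Proof.
move=> [J bJ Jn] [K bK Kn]; exists (K \o J); first exact: bij_comp.
by move=> x; rewrite /= Kn Jn.
Qed.
End isometries.

Theorem theorem3p4 (R : realType) (d : measure_display)
    (Omega : measurableType d) (mu : {measure set Omega -> \bar R}) :
  (exists X : completeNormedModType R,
     isometrically_isomorphic (dual_space X) (LspaceType1 mu) /\
     weakly_Hahn_Banach_smooth X) ->
  exists Gamma : choiceType,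
    isometrically_isomorphic (LspaceType1 mu) (ell1 R Gamma).
Proof.
move=> [X [XL smoothX]]; exists (atom_index mu).
apply: (isometrically_isomorphic_trans (isometrically_isomorphic_sym XL)).
have [K [J KJ JK] Kn] := isometrically_isomorphic_sym XL.
have Jl : linear J := can2_linear KJ JK.
have Jn f : `|J f| = `|f| by rewrite -[in RHS](JK f) Kn.
(* The normalized atoms, carried over to the dual of [X], form the basis; the coordinate of [f] at
   an atom is the integral of [J f] over it. *)
pose a i := K (atom_elt i).
pose coord (i : atom_index mu) (f : dual_space X) : R^o :=
  \int[mu]_(x in val i) J f x.
have coord_linear i : linear (coord i).
  move=> k f g; rewrite /coord Jl.
  exact: (L1_int_linear (atom_index_measurable i)).
pose t (i : atom_index mu) : {linear dual_space X -> R^o} :=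
  HB.pack (coord i) (GRing.isLinear.Build _ _ _ _ (coord i) (coord_linear i)).
apply: (@dual_iso_ell1 _ X _ a t) => //.
- by move=> i; rewrite /a Kn norm_atom_elt.
- by move=> i j; rewrite /= /coord /a KJ int_atom_elt.
- move=> s f us; rewrite -Jn.
  apply: (L1_int_sum_le (J f) us (F := val)).
    exact: atom_index_measurable.
  exact: atom_index_disjoint.
- move=> e [e1 ee].
  have JD f g : J (f + g) = J f + J g by rewrite -[f in LHS]scale1r Jl scale1r.
  (* A surjective linear isometry preserves extreme points of the unit ball, so those of the dual
     are multiples of the [a i]. *)
  have eJ : extreme_unit_ball (J e).
    split=> [|g h g1 h1 gh]; first by rewrite Jn.
    rewrite -[g]KJ; congr J; apply: (ee _ (K h)); rewrite ?Kn//.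
    by rewrite -linearD gh mulr2n linearD !JK.
  have [Je|[i [k Je]]] := extreme_atom eJ.
    by left; rewrite -[e]JK Je linear0.
  by right; exists i, k; rewrite -[e]JK Je linearZ.
Qed.
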